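(* Let $d\ge1$ and let $\{a_{nj}\}_{j=1,\dots,m_n;\ n=1,2,\dots}$ be an array of i.i.d. complex random variables such that (i) $\mathbb{P}(|a_{nj}|>e^{t})=o(1/t^d)$ as $t\to\infty$, and (ii) $\mathcal{Q}(a_{nj};r)\to0$ as $r\to0$. Let $K\subset\mathbb{C}^d$ be compact and regular. For each $n$ let $\{p_{nj}\}_{j=1,\dots,m_n}$ be a basis of $\mathcal{P}_n$ with $p_{n1}\equiv1$ and $\|p_{nj}\|_K\le1$ for $j=1,\dots,m_n$, and let $B_n(z):=\sum_{j=1}^{m_n}|p_{nj}(z)|^2$. Suppose that for any subsequence $Y\subset\mathbb{N}$ there are a further subsequence $Y_0\subset Y$ and a countable dense set of points $\{w_r\}$ in $\mathbb{C}^d$ such that $$\lim_{n\to\infty,\ n\in Y_0}\frac{1}{2n}\log B_n(w_r)=V_K(w_r),\qquad r=1,2,\dots$$ Let $H_n(z):=\sum_{j=1}^{m_n}a_{nj}p_{nj}(z)$. Then, in probability, $$\frac1n\log|H_n|\to V_K\quad\text{in }L^1_{loc}(\mathbb{C}^d).$$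
   Context: $\mathcal{P}_n$ is the space of holomorphic polynomials of degree at most $n$ in $\mathbb{C}^d$, $m_n=\dim\mathcal{P}_n$, and $\|p\|_K=\sup_K|p|$. $L(\mathbb{C}^d)$ is the set of plurisubharmonic functions $u$ on $\mathbb{C}^d$ with $u(z)\le\log|z|+O(1)$ as $|z|\to\infty$. For a nonpluripolar compact set $K$, $V_K(z):=\sup\{u(z):u\in L(\mathbb{C}^d),\ u\le0\text{ on }K\}$; $K$ is regular if $V_K$ is continuous on $\mathbb{C}^d$. The random variables are defined on a probability space $(\Omega,\mathcal{H},\mathbb{P})$ and are nondegenerate (their distribution is not supported at a single point). The concentration function of a complex random variable $X$ is $\mathcal{Q}(X;r):=\sup_{z\in\mathbb{C}}\mathbb{P}(X\in B(z,r))$, where $B(z,r)=\{\zeta\in\mathbb{C}:|\zeta-z|<r\}$. Convergence in probability in $L^1_{loc}(\mathbb{C}^d)$ is convergence in probability with respect to the (metrizable) topology of $L^1_{loc}(\mathbb{C}^d)$; equivalently, every sequence $Y\subset\mathbb{N}$ has a further subsequence $Y_1\subset Y$ along which the convergence in $L^1_{loc}(\mathbb{C}^d)$ holds almost surely. *)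

(* Defs.v *)
From HB Require Import structures.
From mathcomp Require Import all_boot all_order all_algebra.
From mathcomp Require Import complex.
From mathcomp Require Import -(notations) mpoly.
From mathcomp Require Import all_classical all_reals all_analysis.

Set Implicit Arguments.
Unset Strict Implicit.
Unset Printing Implicit Defensive.

Import Order.TTheory GRing.Theory Num.Theory.
Import numFieldNormedType.Exports.

Local Open Scope classical_set_scope.
Local Open Scope ring_scope.
Local Open Scope complex_scope.

(* The norm topology and the Borel sigma-algebra on the complex numbers. *)
HB.instance Definition _ (R : rcfType) :=
  PseudoPointedMetric.copy R[i] R[i]^o.
HB.instance Definition _ (R : rcfType) := NormedModule.copy R[i] R[i]^o.
HB.instance Definition _ (R : realType) :=
  Measurable.copy R[i] (g_sigma_algebraType (@open R[i])).

(* The real-valued modulus; MathComp's `|z| is again an element of R[i]. *)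
Notation cmod := ComplexField.Normc.normc.

Section lebesgue_measure_on_Rn.
Context {R : realType}.

Section cons_measure.
Context (n : nat) (mu : {measure set (n.-tuple R) -> \bar R}).

Definition cons_measure : set (n.+1.-tuple R) -> \bar R :=
  pushforward (mu \x (@lebesgue_measure R))%E
    (fun p : n.-tuple R * R => [the n.+1.-tuple R of p.2 :: p.1]).

Let mcons : measurable_fun setT
  (fun p : n.-tuple R * R => [the n.+1.-tuple R of p.2 :: p.1]).
Proof. exact: measurable_cons. Qed.

Let pushM := measure_function_pushforward__canonical__measure_function_Measure
  (mu \x (@lebesgue_measure R))%E mcons.

HB.instance Definition _ := isMeasure.Build _ _ _ cons_measure
  (measure0 pushM) (measure_ge0 pushM)
  (@measure_semi_sigma_additive _ _ _ pushM).

End cons_measure.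

(* The n-fold product of the one-dimensional Lebesgue measure. *)
Fixpoint lebesgue_tuple (n : nat) : {measure set (n.-tuple R) -> \bar R} :=
  match n with
  | 0 => dirac [tuple]
  | m.+1 => cons_measure (lebesgue_tuple m)
  end.

End lebesgue_measure_on_Rn.

Section complex_space.
Context {R : realType} {d : nat}.
Local Notation Cd := 'rV[R[i]]_d.

Definition enorm (z : Cd) : R := Num.sqrt (\sum_(k < d) cmod (z 0 k) ^+ 2).

(* The identification R^(2d) = C^d: z_k = x_k + i x_(d+k). Integrals over C^d
   are taken over R^(2d) through it. *)
Definition Cd_of_tuple (x : (d + d).-tuple R) : Cd :=
  \row_(k < d) (tnth x (lshift d k) +i* tnth x (rshift d k)).

Definition int_Cd (L : set Cd) (f : Cd -> \bar R) : \bar R :=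
  (\int[lebesgue_tuple (d + d)]_(x in Cd_of_tuple @^-1` L) f (Cd_of_tuple x))%E.

Definition L1loc (f : Cd -> \bar R) : Prop :=
  forall L, compact L ->
    (lebesgue_tuple (d + d)).-integrable (Cd_of_tuple @^-1` L)
      (f \o Cd_of_tuple).

(* Upper semicontinuous, [-oo, +oo[-valued, with the sub-mean value inequality
   on every circle of every complex line. The function -oo is allowed. *)
Definition psh (u : Cd -> \bar R) : Prop :=
  [/\ forall z, (u z < +oo)%E,
      lower_semicontinuous (fun z => (- u z)%E)
    & forall z v, (u z <= ((2 * pi)^-1)%:E *
        \int[lebesgue_measure]_(t in `[0%R, (2 * pi)%R])
          u (z + (cos t +i* sin t) *: v)%R)%E].

Definition pluripolar (E : set Cd) : Prop :=
  exists u, [/\ psh u, exists z, u z != -oo%E & forall z, E z -> u z = -oo%E].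

Definition lelong (u : Cd -> \bar R) : Prop :=
  psh u /\ exists M r0 : R, 0 < r0 /\
    forall z, r0 <= enorm z -> (u z <= (ln (enorm z) + M)%:E)%E.

Definition extremal_fun (K : set Cd) (z : Cd) : \bar R :=
  ereal_sup [set u z | u in
    [set u | lelong u /\ forall x, K x -> (u x <= 0)%E]].

Definition regular_set (K : set Cd) : Prop :=
  ~ pluripolar K /\ continuous (extremal_fun K).

Definition peval (q : mpoly.mpoly d R[i]) (z : Cd) : R[i] :=
  mpoly.meval (fun k => z 0 k) q.

(* mpoly.msize is the total degree plus one (and 0 for the zero polynomial). *)
Definition poly_le (n : nat) : set (mpoly.mpoly d R[i]) :=
  [set q | (mpoly.msize q <= n.+1)%N].

Definition sup_norm (K : set Cd) (q : mpoly.mpoly d R[i]) : \bar R :=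
  ereal_sup [set (cmod (peval q z))%:E | z in K].

(* p n 0, ..., p n (m n - 1) are the basis polynomials of the n-th space. *)
Definition Bfun (m : nat -> nat) (p : nat -> nat -> mpoly.mpoly d R[i])
    (n : nat) (z : Cd) : R :=
  \sum_(j < m n) cmod (peval (p n j) z) ^+ 2.

Definition Hfun (T : Type) (m : nat -> nat)
    (p : nat -> nat -> mpoly.mpoly d R[i]) (a : nat -> nat -> T -> R[i])
    (n : nat) (w : T) (z : Cd) : R[i] :=
  \sum_(j < m n) a n j w * peval (p n j) z.

End complex_space.

Definition array_index (m : nat -> nat) : set (nat * nat) :=
  [set nj | (0 < nj.1)%N /\ (nj.2 < m nj.1)%N].

(* Only the values e 0, ..., e (m - 1) matter; m is then the dimension of the
   subspace S. *)
Definition is_basis (F : fieldType) (V : lmodType F) (S : set V) (m : nat)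
    (e : nat -> V) : Prop :=
  [/\ forall j, (j < m)%N -> S (e j),
      forall c : nat -> F, \sum_(j < m) c j *: e j = 0 ->
        forall j, (j < m)%N -> c j = 0
    & forall v, S v -> exists c : nat -> F, v = \sum_(j < m) c j *: e j].

Section probability.
Context {d0 : measure_display} {T : measurableType d0} {R : realType}.
Variable P : probability T R.

Section iid.
Context {d1 : measure_display} {E : measurableType d1} {I : choiceType}.
Variables (D : set I) (X : I -> {RV P >-> E}).

Definition mutually_independent : Prop :=
  forall (s : seq I) (B : I -> set E), uniq s ->
    (forall i, i \in s -> D i) -> (forall i, i \in s -> measurable (B i)) ->
    P (\bigcap_(i in [set` s]) X i @^-1` B i) =
    (\prod_(i <- s) P (X i @^-1` B i))%E.

Definition identically_distributed : Prop :=
  forall i j, D i -> D j -> forall B, measurable B ->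
    distribution P (X i) B = distribution P (X j) B.

Definition iid : Prop := mutually_independent /\ identically_distributed.

End iid.

Definition nondegenerate_rv (X : T -> R[i]) : Prop :=
  forall z, P (X @^-1` [set z]) != 1%E.

Definition concentration (X : T -> R[i]) (r : R) : \bar R :=
  ereal_sup [set P [set w | cmod (X w - z) < r] | z in [set: R[i]]].

(* The topology of L^1_loc is given by the seminorms of the spaces L^1(L), L
   compact, so convergence in probability is tested on each of them. *)
Definition cvg_in_probability_L1loc (d : nat)
    (F : nat -> T -> 'rV[R[i]]_d -> \bar R) (f : 'rV[R[i]]_d -> \bar R) : Prop :=
  [/\ L1loc f,
      forall n, (0 < n)%N -> {ae P, forall w, L1loc (F n w)}
    & forall (L : set 'rV[R[i]]_d) (eps : R), compact L -> 0 < eps ->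
        P [set w | (eps%:E <= int_Cd L (fun z => `|F n w z - f z|))%E]
          @[n --> \oo] --> 0%E].

End probability.

(* Main.v *)
Require Import Defs.
From HB Require Import structures.
From mathcomp Require Import all_boot all_order all_algebra.
From mathcomp Require Import complex.
From mathcomp Require Import -(notations) mpoly.
From mathcomp Require Import all_classical all_reals all_analysis measurable_realfun.
From mathcomp Require Import ring lra.

Set Implicit Arguments.
Unset Strict Implicit.
Unset Printing Implicit Defensive.

Import Order.TTheory GRing.Theory Num.Theory.
Import numFieldNormedType.Exports.

Local Open Scope classical_set_scope.
Local Open Scope ring_scope.
Local Open Scope complex_scope.

(** Write V for the extremal function of K and u_n = (1/n) log |H_n|. With
    probability tending to one, u_n is squeezed between an upper bound that
    holds everywhere and lower bounds at finitely many points, and the sub-mean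
    value inequality turns such a squeeze into closeness in L^1 on compact sets.

    Upper bound. The functions (1/n) log |p_nj| lie in the Lelong class, since
    log |q| satisfies the sub-mean value inequality on circles by Jensen's
    inequality (jensen_horner), and they are at most 0 on K. So they are at most
    V (log_peval_le_extremal). As m_n <= (n+1)^d, the tail condition makes all
    |a_nj| at most e^(dl n) outside an event of small probability
    (large_coefficients_rare), and there u_n <= V + 2 dl for large n.

    Lower bound. Conditioning on all terms but the largest shows that H_n(z) is
    at most as concentrated as that term (small_ball_sum). Hence
    |H_n(z)| >= e^(- dl n) B_n(z)^(1/2) outside an event of small probability
    (small_values_rare). At the points w_r, where (1/2n) log B_n tends to V
    along a sequence of indices, this means u_n >= V - 2 dl for large n there.

    From points to L^1. If u_n <= M on a polydisc, the integral of M - u_n over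
    it is at most its volume times the value of M - u_n at the centre
    (area_submean): the circle inequality is averaged over rotations, which
    preserve volume because they are products of shears. Since V is continuous,
    on a small polydisc centred at some w_r the constant M can be taken close to
    V, so that u_n is close to V in L^1 there. Finitely many such polydiscs, of
    bounded total volume, cover a given compact set
    (L1_small_of_finitely_many_points).

    These arguments need V to be finite. Near a point of K one has V <= 1, so
    |p_nj| <= e^n there, and the Bernstein-Walsh inequality for polynomials
    bounds (1/2n) log B_n on bounded sets; the limits at the dense set of points
    w_r and the continuity of V then bound V (extremal_fun_lty).

    If convergence in probability failed, some deviation would keep a probability
    at least e along an infinite set of indices. The hypothesis on B_n,
    applied to this set, provides a further infinite set along which the squeeze
    holds, which is a contradiction. *)

(** * Integrals over intervals and the unit circle *)

Section circle_integrals.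
Context {R : realType}.
Local Notation mu := (@lebesgue_measure R).
Implicit Types (F : R -> R) (a b c h t : R).

Lemma measurable_shift c :
  measurable_fun setT ((fun x => x + c) : measurableTypeR R -> measurableTypeR R).
Proof.
apply: continuous_measurable_fun => x.
by apply: cvgD; [exact: cvg_id|exact: cvg_cst].
Qed.

Lemma lebesgue_measure_shift c (A : set R) : measurable A ->
  pushforward mu ((fun x => x + c) : _ -> measurableTypeR R) A = mu A.
Proof.
move=> mA; apply/esym/lebesgue_measure_unique => //=.
  exact: measurable_shift.
move=> _ _ [[a b]] _ <-; rewrite /pushforward.
have -> : (fun x => x + c) @^-1` `]a, b]%classic = `]a - c, b - c]%classic.
  by apply/seteqP; split => x /=; rewrite !in_itv/= ltrBlDr lerBrDr.
rewrite !lebesgue_measure_itv/= !lte_fin ltrD2r.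
by case: ifP => // _; rewrite -!EFinB; congr EFin; ring.
Qed.

Lemma ge0_integral_shift c (f : R -> \bar R) : measurable_fun setT f ->
  (forall x, 0 <= f x)%E ->
  (\int[mu]_x f (x + c)%R = \int[mu]_x f x)%E.
Proof.
move=> mf f0.
transitivity (\int[pushforward mu
    ((fun x => x + c)%R : measurableTypeR R -> measurableTypeR R)]_x f x)%E.
  by rewrite ge0_integral_pushforward//; exact: measurable_shift.
apply: eq_measure_integral => [|ms A mA _]; first exact: measurable_shift.
exact: lebesgue_measure_shift.
Qed.

Lemma continuous_integrable_itv F a b : continuous F ->
  mu.-integrable `[a, b] (EFin \o F).
Proof.
move=> cF; apply: continuous_compact_integrable; first exact: segment_compact.
exact: continuous_subspaceT.
Qed.

Lemma Rintegral_shift F a b c : continuous F ->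
  \int[mu]_(x in `[a, b]) F (x + c) = \int[mu]_(x in `[a + c, b + c]) F x.
Proof.
move=> cF; rewrite /Rintegral; congr fine.
have cFc : continuous (fun x => F (x + c)).
  move=> x; apply: (@continuous_comp _ _ _ (fun x => x + c) F); last exact: cF.
  by apply: cvgD; [exact: cvg_id|exact: cvg_cst].
have -> : `[a, b]%classic = (fun x => x + c) @^-1` `[a + c, b + c]%classic.
  by apply/seteqP; split => x /=; rewrite !in_itv/= !lerD2r.
rewrite -(@integral_pushforward _ _ (measurableTypeR R) (measurableTypeR R) R _
  (measurable_shift c) mu `[a + c, b + c]%classic (EFin \o F))//.
- by apply: eq_measure_integral => [|ms A mA _]; [exact: measurable_shift|exact: lebesgue_measure_shift].
- apply/measurable_EFinP; exact: continuous_measurable_fun.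
- have -> : (fun x => x + c) @^-1` `[a + c, b + c]%classic = `[a, b]%classic.
    by apply/seteqP; split => x /=; rewrite !in_itv/= !lerD2r.
  exact: (continuous_integrable_itv a b cFc).
Qed.

(** Splits off the second half and translates it back: iterated, this
    replaces a periodic substitution by averaging over roots of unity. *)
Lemma Rintegral_halve F h : 0 <= h -> continuous F ->
  \int[mu]_(x in `[0, h *+ 2]) F x = \int[mu]_(x in `[0, h]) (F x + F (x + h)).
Proof.
move=> h0 cF.
have cFc : continuous (fun x => F (x + h)).
  move=> x; apply: (@continuous_comp _ _ _ (fun x => x + h) F); last exact: cF.
  by apply: cvgD; [exact: cvg_id|exact: cvg_cst].
rewrite RintegralD//; [|exact: continuous_integrable_itv..].
rewrite Rintegral_shift// add0r -mulr2n.
have := @Rintegral_itvB R F (BLeft 0) (BRight (h *+ 2)) h.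
rewrite -(@Rintegral_itv_obnd_cbnd _ h); last first.
  apply: integrableS (continuous_integrable_itv 0 (h *+ 2) cF) => //.
  by apply: subset_itv; rewrite bnd_simp.
move=> <-; rewrite ?bnd_simp// ?mulr2n ?lerDl//; first by rewrite addrC subrK.
exact: continuous_integrable_itv.
Qed.

Lemma normr_Rintegral_le F a b M : a <= b -> continuous F ->
  (forall x, `|F x| <= M) ->
  `|\int[mu]_(x in `[a, b]) F x| <= M * (b - a).
Proof.
move=> ab cF FM.
apply: le_trans (le_normr_Rintegral _ _) _ => //; first exact: continuous_integrable_itv.
have cn : continuous (fun x => `|F x|).
  by move=> x; apply: continuous_comp; [exact: cF|exact: norm_continuous].
apply: (@le_trans _ _ (\int[mu]_(x in `[a, b]) cst M x)).
  apply: le_Rintegral => //; first exact: (continuous_integrable_itv a b cn).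
  by apply: (@continuous_integrable_itv (cst M)) => x; exact: cvg_cst.
rewrite Rintegral_cst//; have := @lebesgue_measure_itv R `[a, b].
rewrite /= lte_fin => ->; move: ab; rewrite le_eqVlt => /predU1P[->|->] //=.
by rewrite ltxx subrr.
Qed.
End circle_integrals.

Section cis.
Context {R : realType}.
Definition cis (t : R) : R[i] := cos t +i* sin t.

Lemma cmod_cis t : cmod (cis t) = 1.
Proof. by rewrite /cis /= cos2Dsin2 sqrtr1. Qed.

Lemma cisD s t : cis (s + t) = cis s * cis t.
Proof.
rewrite /cis cosD sinD; apply/eqP.
by rewrite eq_complex /= addrC [X in _ && (_ == X)]addrC !eqxx.
Qed.

Lemma continuous_cmod_cis (x y : R[i]) (c : R) :
  continuous (fun t : R => cmod (x - y * cis (c * t))).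
Proof.
case: x => u v; case: y => a b t /=.
have cc : continuous (fun t : R => cos (c * t)).
  move=> s; apply: continuous_comp; last exact: continuous_cos.
  apply: cvgM; [exact: cvg_cst|exact: cvg_id].
have cs : continuous (fun t : R => sin (c * t)).
  move=> s; apply: continuous_comp; last exact: continuous_sin.
  apply: cvgM; [exact: cvg_cst|exact: cvg_id].
have cRe : continuous (fun t : R => u - (a * cos (c * t) - b * sin (c * t))).
  move=> s; apply: cvgB; first exact: cvg_cst.
  by apply: cvgB; (apply: cvgM; first exact: cvg_cst); [exact: cc|exact: cs].
have cIm : continuous (fun t : R => v - (a * sin (c * t) + b * cos (c * t))).
  move=> s; apply: cvgB; first exact: cvg_cst.
  by apply: cvgD; (apply: cvgM; first exact: cvg_cst); [exact: cs|exact: cc].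
apply: continuous_comp; last exact: sqrt_continuous.
by apply: cvgD; apply: cvgM; [exact: cRe|exact: cRe|exact: cIm|exact: cIm].
Qed.
End cis.

(** * Mean values of logarithms on the unit circle *)

Section jensen.
Context {R : realType}.
Local Notation mu := (@lebesgue_measure R).
Implicit Types (w x y : R[i]) (t c h eta : R).

Lemma cmod_ge0 x : 0 <= cmod x.
Proof. by case: x => a b; exact: sqrtr_ge0. Qed.

Lemma cmod_sqr x : cmod x ^+ 2 = complex.Re x ^+ 2 + complex.Im x ^+ 2.
Proof. by case: x => a b /=; rewrite sqr_sqrtr// addr_ge0// sqr_ge0. Qed.

Lemma cmodM x y : cmod (x * y) = cmod x * cmod y.
Proof. exact: ComplexField.Normc.normcM. Qed.

Lemma cmodD x y : cmod (x + y) <= cmod x + cmod y.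
Proof. exact: le_normcD. Qed.

Lemma cmodN x : cmod (- x) = cmod x.
Proof. exact: normcN. Qed.

Lemma cmodB x y : cmod (x - y) = cmod (y - x).
Proof. by rewrite -cmodN opprB. Qed.

Lemma cmodX x n : cmod (x ^+ n) = cmod x ^+ n.
Proof.
elim: n => [|n IH]; first by rewrite !expr0 ComplexField.Normc.normc1.
by rewrite !exprS cmodM IH.
Qed.

Lemma cmod0P x : cmod x = 0 -> x = 0.
Proof. exact: ComplexField.Normc.eq0_normc. Qed.

Lemma cmod_gt0 x : (0 < cmod x) = (x != 0).
Proof.
rewrite lt0r cmod_ge0 andbT; apply/idP/idP; apply: contra => /eqP.
  by move=> ->; rewrite ComplexField.Normc.normc0.
by move/cmod0P ->.
Qed.

Lemma cmod_sum_le (I : Type) (r : seq I) (P : pred I) (F : I -> R[i]) :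
  cmod (\sum_(i <- r | P i) F i) <= \sum_(i <- r | P i) cmod (F i).
Proof.
elim/big_rec2: _ => [|i u v _ uv]; first by rewrite ComplexField.Normc.normc0.
by apply: le_trans (cmodD _ _) _; rewrite lerD2l.
Qed.

Lemma cmod_prod (I : Type) (r : seq I) (P : pred I) (F : I -> R[i]) :
  cmod (\prod_(i <- r | P i) F i) = \prod_(i <- r | P i) cmod (F i).
Proof. exact: (big_morph _ cmodM (ComplexField.Normc.normc1 R)). Qed.

Lemma cmod_mul_cis y t : cmod (y * cis t) = cmod y.
Proof. by rewrite cmodM cmod_cis mulr1. Qed.

Lemma cmod_1B_cis_bounds y t : cmod y < 1 ->
  1 - cmod y <= cmod (1 - y * cis t) <= 1 + cmod y.
Proof.
move=> y1; apply/andP; split.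
  have := cmodD (1 - y * cis t) (y * cis t).
  by rewrite subrK cmod_mul_cis ComplexField.Normc.normc1 lerBlDr.
have := cmodD 1 (- (y * cis t)).
by rewrite cmodN cmod_mul_cis ComplexField.Normc.normc1.
Qed.

Lemma continuous_ln_cmod_cis y c : cmod y < 1 ->
  continuous (fun t => ln (cmod (1 - y * cis (c * t)))).
Proof.
move=> y1 t; apply: (@continuous_comp _ _ _ (fun t => cmod (1 - y * cis (c * t)))).
  exact: continuous_cmod_cis.
apply: continuous_ln.
have /andP[+ _] := cmod_1B_cis_bounds (c * t) y1.
by apply: lt_le_trans; rewrite subr_gt0.
Qed.

(** (1 - y e^(is)) (1 + y e^(is)) = 1 - y^2 e^(2is), and adding h to t changes
    the sign of e^(ict). *)
Lemma ln_cmod_cis_duplication y c h t : cmod y < 1 -> c * h = pi ->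
  ln (cmod (1 - y * cis (c * t))) + ln (cmod (1 - y * cis (c * (t + h)))) =
  ln (cmod (1 - y ^+ 2 * cis (c *+ 2 * t))).
Proof.
move=> y1 ch.
have pos s : 0 < cmod (1 - y * cis s).
  have /andP[+ _] := cmod_1B_cis_bounds s y1.
  by apply: lt_le_trans; rewrite subr_gt0.
rewrite -lnM ?posrE// -cmodM; congr (ln (cmod _)).
have -> : c * (t + h) = c * t + pi by rewrite mulrDr ch.
rewrite cisD.
have -> : cis (pi : R) = -1.
  by rewrite /cis cospi sinpi; apply/eqP; rewrite eq_complex /= oppr0 !eqxx.
have -> : cis (c *+ 2 * t) = cis (c * t) * cis (c * t).
  by rewrite mulr2n mulrDl cisD.
ring.
Qed.

(** The mean value property of log |1 - z| on circles in the unit disc, by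
    iterating the duplication formula. *)
Lemma mean_ln_cmod_1B_cis y : cmod y < 1 ->
  \int[mu]_(t in `[0, 2 * pi]) ln (cmod (1 - y * cis t)) = 0.
Proof.
move=> y1; set I := Rintegral _ _ _.
have yk k : cmod (y ^+ (2 ^ k)) <= cmod y.
  rewrite cmodX -[leRHS]expr1 ler_wiXn2l ?cmod_ge0 ?(ltW y1)//.
  by rewrite expn_gt0.
have yk1 k : cmod (y ^+ (2 ^ k)) < 1 := le_lt_trans (yk k) y1.
(* Each doubling halves the interval and squares y; the integrand stays
   bounded, so the integral over the shrinking interval tends to 0. *)
have IE k : I = \int[mu]_(t in `[0, (pi / 2 ^+ k) *+ 2])
    ln (cmod (1 - y ^+ (2 ^ k) * cis (2 ^+ k * t))).
  elim: k => [|k ->].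
    rewrite expr0 divr1 expr1 /I [2 * pi]mulr_natl.
    by apply: eq_Rintegral => t _; rewrite mul1r.
  have hk : pi / 2 ^+ k = (pi / 2 ^+ k.+1) *+ 2 :> R.
    by rewrite exprS -mulr_natl; field; rewrite expf_neq0.
  rewrite Rintegral_halve.
  - rewrite hk; apply: eq_Rintegral => t _.
    rewrite -hk ln_cmod_cis_duplication// -?exprM ?expnSr//.
      by rewrite [2 ^+ k.+1]exprS [2 * 2 ^+ k]mulr_natl.
    by rewrite mulrC divfK// expf_neq0.
  - by rewrite divr_ge0 ?pi_ge0// exprn_ge0.
  - exact: continuous_ln_cmod_cis.
pose M := ln 2 - ln (1 - cmod y).
have FM k t : `|ln (cmod (1 - y ^+ (2 ^ k) * cis (2 ^+ k * t)))| <= M.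
  have /andP[l u] := cmod_1B_cis_bounds (2 ^+ k * t) (yk1 k).
  have l' : 1 - cmod y <= cmod (1 - y ^+ (2 ^ k) * cis (2 ^+ k * t)).
    by apply: le_trans l; rewrite lerB.
  have u' : cmod (1 - y ^+ (2 ^ k) * cis (2 ^+ k * t)) <= 2.
    apply: le_trans u _; rewrite -[leRHS]/(1 + 1) lerD2l.
    exact: le_trans (yk k) (ltW y1).
  have y0 : 0 < 1 - cmod y by rewrite subr_gt0.
  have ln20 : 0 <= ln (2 : R) by rewrite ln_ge0// ler1n.
  have lny : ln (1 - cmod y) <= 0 by rewrite ln_le0// gerBl cmod_ge0.
  have := ler_ln y0 (lt_le_trans y0 l'); rewrite l' => ll.
  have := ler_ln (lt_le_trans y0 l') (ltr0n R 2); rewrite u' => lu.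
  rewrite ler_norml /M; apply/andP; split; lra.
have M0 : 0 <= M by apply: le_trans (FM 0%N 0); exact: normr_ge0.
have IM k : `|I| <= M * (2 * pi) / 2 ^+ k.
  rewrite (IE k).
  apply: le_trans (normr_Rintegral_le (M := M) _ _ _) _.
  - by rewrite mulrn_wge0// divr_ge0 ?pi_ge0// exprn_ge0.
  - exact: continuous_ln_cmod_cis.
  - exact: FM.
  - by rewrite subr0 le_eqVlt; apply/orP; left; apply/eqP; rewrite -mulr_natl; ring.
apply/eqP; rewrite -normr_eq0 eq_le normr_ge0 andbT; apply/ler_addgt0Pl => e e0.
rewrite addr0.
have [k kM] : exists k, M * (2 * pi) / e <= 2 ^+ k.
  exists (Num.Def.archi_bound (M * (2 * pi) / e)).
  have : M * (2 * pi) / e < (Num.Def.archi_bound (M * (2 * pi) / e))%:R.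
    by apply: archi_boundP; rewrite divr_ge0 ?(ltW e0)// !mulr_ge0// pi_ge0.
  move=> /ltW/le_trans; apply; rewrite -natrX ler_nat.
  exact/ltnW/ltn_expl.
apply: le_trans (IM k) _; rewrite ler_pdivrMr ?exprn_gt0//.
by move: kM; rewrite ler_pdivrMr// [_ * e]mulrC.
Qed.

(** Adding eta > 0 to |e^(it) - w|^2 keeps it of the form
    A - 2 Re (conj(w) e^(it)), now with A > 2 |w|, so that it is a constant C
    times |1 - y e^(it)|^2 with |y| < 1, where the mean value is known. *)
Lemma ln_cmod_reg w eta : 0 < eta ->
  exists (C : R) (y : R[i]), [/\ 0 < C, Num.max 1 (cmod w) ^+ 2 <= C, cmod y < 1 &
    forall t, cmod (cis t - w) ^+ 2 + eta = C * cmod (1 - y * cis t) ^+ 2].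
Proof.
move=> eta0; case: w => u v.
pose W := u ^+ 2 + v ^+ 2; pose A := 1 + W + eta.
have W0 : 0 <= W by rewrite addr_ge0 ?sqr_ge0.
pose S := Num.sqrt (A ^+ 2 - 4 * W).
have DA : A ^+ 2 - 4 * W = (1 - W) ^+ 2 + eta * (2 + 2 * W + eta) by rewrite /A; ring.
have D0 : 0 <= A ^+ 2 - 4 * W.
  by rewrite DA addr_ge0 ?sqr_ge0// mulr_ge0 ?ltW//; lra.
have SE : S ^+ 2 = A ^+ 2 - 4 * W by rewrite sqr_sqrtr.
have S0 : 0 <= S by exact: sqrtr_ge0.
have SW : `|1 - W| <= S.
  rewrite -[leLHS]ger0_norm// -ler_sqr ?nnegrE// ger0_norm// real_normK ?num_real//.
  by rewrite SE DA lerDl mulr_ge0 ?ltW//; lra.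
move: SW; rewrite ler_norml => /andP[SW1 SW2].
(* The larger root of C^2 - A C + W = 0, which makes conj(w) / C the
   coefficient of the factored form. *)
pose C := (A + S) / 2.
have C1 : 1 < C by rewrite /C /A; lra.
have CW : W < C by rewrite /C /A; lra.
have CE : C ^+ 2 + W = A * C.
  have e1 : 4 * (C ^+ 2 + W) = A ^+ 2 + 2 * (A * S) + S ^+ 2 + 4 * W.
    by rewrite /C; field.
  have e2 : 4 * (A * C) = 2 * A ^+ 2 + 2 * (A * S) by rewrite /C; field.
  by move: e1 e2; rewrite SE; lra.
have C0 : C != 0 by rewrite gt_eqF// (lt_trans _ C1).
have cW : cmod (u +i* v) ^+ 2 = W by rewrite cmod_sqr.
exists C, ((u / C) +i* (- v / C)); split.
- lra.
- rewrite /Num.max; case: ifP => _; last by rewrite expr1n ltW.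
  by rewrite cW ltW.
- have : cmod ((u / C) +i* (- v / C)) ^+ 2 < 1.
    rewrite cmod_sqr /= !exprMn sqrrN -mulrDl exprVn ltr_pdivrMr ?exprn_gt0 ?(lt_trans _ C1)// mul1r.
    by apply: lt_le_trans CW _; rewrite expr2 ler_pMl ?ltW// (lt_trans _ C1).
  by rewrite -[X in _ < X](expr1n _ 2) ltr_sqr ?nnegrE ?cmod_ge0.
- move=> t; rewrite !cmod_sqr /=.
  have cs := cos2Dsin2 t.
  have -> : (cos t - u) ^+ 2 + (sin t - v) ^+ 2 + eta =
     (cos t ^+ 2 + sin t ^+ 2) + W + eta - 2 * (u * cos t + v * sin t) by rewrite /W; ring.
  have -> : C * ((1 - (u / C * cos t - - v / C * sin t)) ^+ 2 +
     (0 - (u / C * sin t + - v / C * cos t)) ^+ 2) =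
     C + (W / C) * (cos t ^+ 2 + sin t ^+ 2) - 2 * (u * cos t + v * sin t).
    by rewrite /W; field.
  rewrite cs -/A; have : C + W / C = A.
    by apply: (mulIf C0); rewrite mulrDl divfK// -expr2.
  lra.
Qed.

Lemma mean_ln_reg_ge w eta : 0 < eta ->
  2 * pi * ln (Num.max 1 (cmod w)) <=
  \int[mu]_(t in `[0, 2 * pi]) (ln (cmod (cis t - w) ^+ 2 + eta) / 2).
Proof.
move=> eta0; have [C [y [C0 wC y1 E]]] := ln_cmod_reg w eta0.
have pos s : 0 < cmod (1 - y * cis s).
  have /andP[+ _] := cmod_1B_cis_bounds s y1.
  by apply: lt_le_trans; rewrite subr_gt0.
have -> : \int[mu]_(t in `[0, 2 * pi]) (ln (cmod (cis t - w) ^+ 2 + eta) / 2) =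
    \int[mu]_(t in `[0, 2 * pi]) (ln C / 2 + ln (cmod (1 - y * cis t))).
  apply: eq_Rintegral => t _; rewrite E lnM ?posrE ?exprn_gt0// lnXn//.
  by rewrite mulrDl; congr (_ + _); rewrite -[ln _ *+ 2]mulr_natr mulfK.
have pi20 : 0 <= 2 * pi :> R by rewrite mulr_ge0 ?pi_ge0.
have c1 : continuous (fun t => ln (cmod (1 - y * cis t))).
  move=> t; have := @continuous_ln_cmod_cis y 1 y1 t.
  by under eq_fun do rewrite mul1r.
rewrite RintegralD//; last 2 first.
  - by apply: (@continuous_integrable_itv _ (cst (ln C / 2))) => x; exact: cvg_cst.
  - exact: (@continuous_integrable_itv _ _ _ _ c1).
rewrite mean_ln_cmod_1B_cis// addr0 Rintegral_cst//.
have := @lebesgue_measure_itv R `[0, 2 * pi].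
rewrite /= lte_fin => ->; rewrite mulr_gt0 ?pi_gt0//= subr0 mulrC ler_pM2r ?mulr_gt0 ?pi_gt0//.
have m0 : 0 < Num.max 1 (cmod w) by rewrite lt_max ltr01.
rewrite ler_pdivlMr// mulr_natr -lnXn// ler_ln ?posrE ?exprn_gt0//.
Qed.
End jensen.

(** * Jensen's inequality for polynomials in one variable *)

Section lne_facts.
Context {R : realType}.
Implicit Types (x y : R).

Lemma lneM_ge0 x y : 0 <= x -> 0 <= y ->
  lne (x * y)%:E = (lne x%:E + lne y%:E)%E.
Proof.
have l0 : lne (0 : R)%:E = -oo%E by rewrite le0_lneNy.
rewrite !le_eqVlt => /predU1P[<-|x0] /predU1P[<-|y0].
- by rewrite mul0r l0.
- by rewrite mul0r l0.
- by rewrite mulr0 l0 addeNy.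
- by rewrite !lne_EFin ?mulr_gt0// lnM.
Qed.

Lemma measurable_lne_EFin d (T : measurableType d) (f : T -> R) :
  measurable_fun setT f -> measurable_fun setT (fun t => lne (f t)%:E).
Proof.
move=> mf; rewrite /lne; apply: measurable_fun_ifT => //=.
- exact: measurable_fun_ler.
- by apply/measurable_EFinP; apply: measurableT_comp.
Qed.

(** The regularised logarithms decrease to the logarithm, with value -oo at 0. *)
Lemma cvg_ln_reg x : 0 <= x ->
  (ln (x ^+ 2 + k.+1%:R^-1) / 2)%:E @[k --> \oo] --> lne x%:E.
Proof.
rewrite le_eqVlt => /predU1P[<-|x0].
  rewrite le0_lneNy//; apply/cvgeNyPle => A.
  near=> k; rewrite lee_fin expr0n/= add0r lnV ?posrE//.
  rewrite ler_pdivrMr// -lerN2 opprK -[leLHS]expRK ler_ln ?posrE ?expR_gt0//.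
  apply: (@le_trans _ _ k%:R); last by rewrite ler_nat.
  by near: k; exact: nbhs_infty_ger.
rewrite lne_EFin//; apply: cvg_EFin; first exact: nearW.
have -> : ln x = ln (x ^+ 2 + 0) / 2.
  by rewrite addr0 lnXn// -[_ *+ 2]mulr_natr mulfK.
apply: cvgMr_tmp.
apply: continuous_cvg.
  by apply: continuous_ln; rewrite addr0 exprn_gt0.
by apply: cvgD; [exact: cvg_cst|exact: cvg_harmonic].
Unshelve. all: by end_near. Qed.

End lne_facts.

Section jensen_polynomial.
Context {R : realType}.
Local Notation mu := (@lebesgue_measure R).
Local Notation D := (`[0, 2 * pi]%classic : set R).

Lemma measurable_cmod_cis (w : R[i]) :
  measurable_fun setT (fun t : R => cmod (cis t - w)).
Proof.
apply: continuous_measurable_fun.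
have := @continuous_cmod_cis R w 1 1.
by under eq_fun do rewrite !mul1r cmodB.
Qed.

Lemma mu_circle : mu D = (2 * pi)%:E.
Proof.
have := @lebesgue_measure_itv R `[0, 2 * pi].
by rewrite /= lte_fin => ->; rewrite mulr_gt0 ?pi_gt0//= oppr0 adde0.
Qed.

Lemma integral_cst_circle (c : R) : (\int[mu]_(t in D) c%:E = (2 * pi * c)%:E)%E.
Proof.
rewrite integral_cst//.
by rewrite EFinM muleC; congr (_ * _)%E; exact: mu_circle.
Qed.

(** The inequality that Jensen's formula gives for one factor, with its
    integrability; a root on the circle is reached by monotone convergence
    from the regularised logarithms. *)
Lemma jensen_root (w : R[i]) :
  mu.-integrable D (fun t => lne (cmod (cis t - w))%:E) /\
  ((2 * pi * ln (Num.max 1 (cmod w)))%:E <=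
     \int[mu]_(t in D) lne (cmod (cis t - w))%:E)%E.
Proof.
pose x t := cmod (cis t - w).
pose L k t := ln (x t ^+ 2 + k.+1%:R^-1) / 2.
(* M bounds all the regularisations from above, so that M - L k is a
   nondecreasing sequence of nonnegative functions. *)
pose M : R := ln ((1 + cmod w) ^+ 2 + 1) / 2.
have x0 t : 0 <= x t by exact: cmod_ge0.
have xw t : x t <= 1 + cmod w.
  by have := cmodD (cis t) (- w); rewrite cmodN cmod_cis.
have pk k : 0 < k.+1%:R^-1 :> R by rewrite invr_gt0.
have mx : measurable_fun setT x by exact: measurable_cmod_cis.
have mL k : measurable_fun setT (L k).
  apply: measurable_funM => //; apply: measurableT_comp => //.
  by apply: measurable_funD => //; exact: measurable_funX.
have LM k t : L k t <= M.
  rewrite ler_pM2r// ler_ln ?posrE ?ltr_wpDl ?sqr_ge0//.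
  rewrite lerD//; last by rewrite invf_le1// ler1n.
  by rewrite ler_sqr ?nnegrE// (le_trans _ (xw t)).
have mML k : measurable_fun setT (fun t => M - L k t).
  by apply: measurable_funB; [exact: measurable_cst|exact: mL].
have mMLE k : @measurable_fun _ _ (measurableTypeR R) _ D (fun t => (M - L k t)%:E).
  apply/measurable_EFinP.
  by have := @measurable_funTS _ _ (measurableTypeR R) _ D _ (mML k); apply.
have Lnd t : {homo (fun k => (M - L k t)%:E) : m n / (m <= n)%N >-> (m <= n)%E}.
  move=> m n mn; rewrite lee_fin lerB// ler_pM2r// ler_ln ?posrE ?ltr_wpDl ?sqr_ge0//.
  by rewrite lerD2l lef_pV2 ?posrE// ler_nat.
have Lcvg t : (M - L k t)%:E @[k --> \oo] --> (M%:E - lne (x t)%:E)%E.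
  under eq_fun do rewrite EFinB.
  apply: cvgeB; [|exact: cvg_cst|exact: cvg_ln_reg].
  by rewrite fin_num_adde_defr.
have mD : measurable (D : set (measurableTypeR R)) by exact: measurable_itv.
have cM (c : R) : mu.-integrable D (EFin \o cst c).
  by apply: continuous_integrable_itv => ?; exact: cvg_cst.
have cL k : continuous (L k).
  move=> t; apply: cvgMr_tmp; apply: continuous_cvg.
    by apply: continuous_ln; rewrite ltr_wpDl ?sqr_ge0.
  apply: cvgD; last exact: cvg_cst.
  have cx : continuous x.
    have := @continuous_cmod_cis R w 1 1.
    by under eq_fun do rewrite !mul1r cmodB.
  by rewrite expr2; apply: cvgM; exact: cx.
have IL k : (\int[mu]_(t in D) (M - L k t)%:E <= (2 * pi * (M - ln (Num.max 1 (cmod w))))%:E)%E.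
  have iL := continuous_integrable_itv 0 (2 * pi) (cL k).
  rewrite -[leLHS]fineK; last first.
    apply: integrable_fin_num => //.
    have := integrableB mD (cM M) iL; apply: eq_integrable => // t _.
  rewrite lee_fin -[leLHS]/(Rintegral mu D (fun t => M - L k t)).
  rewrite RintegralB//; last exact: (cM M).
  rewrite Rintegral_cst// [fine _](_ : _ = 2 * pi); last exact: (congr1 fine mu_circle).
  rewrite mulrBr [M * _]mulrC lerD2l lerN2.
  exact: mean_ln_reg_ge.
pose G t := (M%:E - lne (x t)%:E)%E.
have mG : measurable_fun setT G.
  by apply: emeasurable_funB => //; exact: measurable_lne_EFin.
have G0 t : (0 <= G t)%E.
  apply: (cvge_ge _ (Lcvg t)); apply: nearW => k.
  by rewrite lee_fin subr_ge0.
have IG : (\int[mu]_(t in D) G t <= (2 * pi * (M - ln (Num.max 1 (cmod w))))%:E)%E.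
  have -> : (\int[mu]_(t in D) G t = \int[mu]_(t in D) limn (fun k => (M - L k t)%:E))%E.
    by apply: eq_integral => t _; apply/esym/cvg_lim => //; exact: Lcvg.
  rewrite monotone_convergence//; last first.
    by move=> k t _; rewrite lee_fin subr_ge0.
  apply: lime_le; last exact: nearW.
  apply: ereal_nondecreasing_is_cvgn => m n mn.
  apply: ge0_le_integral => //.
  - by move=> t _; rewrite lee_fin subr_ge0.
  - by move=> t _; exact: Lnd.
have iG : mu.-integrable D G.
  apply/integrableP; split; first exact: measurable_funTS.
  under eq_integral do rewrite gee0_abs//.
  by apply: le_lt_trans IG _; rewrite ltry.
have xG t : lne (x t)%:E = (M%:E - G t)%E.
  rewrite /G /lne; case: ifP => _ //.
  by rewrite -!EFinB; congr EFin; ring.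
split.
  by have := integrableB mD (cM M) iG; apply: eq_integrable => // t _; rewrite xG.
under eq_integral do rewrite -/(x _) xG.
rewrite integralB//; last exact: (cM M).
rewrite integral_cst_circle.
apply: (@le_trans _ _ ((2 * pi * M)%:E - (2 * pi * (M - ln (Num.max 1 (cmod w))))%:E)%E).
  by rewrite -EFinB lee_fin; lra.
by rewrite leeB.
Qed.


Lemma jensen_prod (c : R[i]) (r : seq R[i]) (f : R -> \bar R) : c != 0 ->
  (forall t, f t = lne (cmod (c * \prod_(z <- r) (cis t - z)))%:E) ->
  mu.-integrable D f /\
  ((2 * pi * (ln (cmod c) + \sum_(z <- r) ln (Num.max 1 (cmod z))))%:E <=
     \int[mu]_(t in D) f t)%E.
Proof.
move=> c0 fE; have mD : measurable (D : set (measurableTypeR R)) by exact: measurable_itv.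
have iroot z := (jensen_root z).1.
have ic : mu.-integrable D (EFin \o cst (ln (cmod c))).
  by apply: continuous_integrable_itv => ?; exact: cvg_cst.
have fS t : f t = ((ln (cmod c))%:E + \sum_(z <- r) lne (cmod (cis t - z))%:E)%E.
  rewrite fE cmodM lneM_ge0 ?cmod_ge0// lne_EFin ?cmod_gt0//; congr (_ + _)%E.
  elim: r {f fE} => [|z r IH].
    by rewrite !big_nil ComplexField.Normc.normc1 lne1.
  by rewrite !big_cons cmodM lneM_ge0 ?cmod_ge0// IH.
have isum : mu.-integrable D (fun t => \sum_(z <- r) lne (cmod (cis t - z))%:E)%E.
  exact: integrable_sum.
split.
  by have := integrableD mD ic isum; apply: eq_integrable => // t _; rewrite fS.
under eq_integral do rewrite fS.
rewrite integralD// integral_sum//= integral_cst_circle.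
rewrite mulrDr EFinD; apply: leeD => //.
rewrite mulr_sumr -sumEFin; apply: lee_sum => z _.
exact: (jensen_root z).2.
Qed.

End jensen_polynomial.

Section jensen_horner.
Context {R : realType}.
Local Notation mu := (@lebesgue_measure R).
Local Notation D := (`[0, 2 * pi]%classic : set R).
Implicit Types q : {poly R[i]}.

(** The logarithm of the modulus of a polynomial is subharmonic: each root z
    contributes log max (1, |z|) >= log |z| to the mean over the unit circle. *)
Lemma jensen_horner q : q.[0] != 0 ->
  mu.-integrable D (fun t => lne (cmod q.[cis t])%:E) /\
  ((2 * pi * ln (cmod q.[0]))%:E <= \int[mu]_(t in D) lne (cmod q.[cis t])%:E)%E.
Proof.
move=> q0; have [r qr] := closed_field_poly_normal q.
have qx x : q.[x] = lead_coef q * \prod_(z <- r) (x - z).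
  rewrite {1}qr hornerZ horner_prod; congr (_ * _).
  by apply: eq_bigr => z _; rewrite hornerXsubC.
have lq : lead_coef q != 0.
  by apply: contra q0; rewrite lead_coef_eq0 => /eqP ->; rewrite horner0.
have [iq le_q] := jensen_prod (f := fun t => lne (cmod q.[cis t])%:E) lq
  (fun t => congr1 (fun x => lne (cmod x)%:E) (qx (cis t))).
split=> //; apply: le_trans le_q; rewrite lee_fin ler_pM2l ?mulr_gt0 ?pi_gt0//.
rewrite qx cmodM lnM ?posrE ?cmod_gt0//; last first.
  by move: q0; rewrite qx mulf_eq0 negb_or => /andP[].
rewrite lerD2l.
have {q0}: \prod_(z <- r) (0 - z) != 0.
  by move: q0; rewrite qx mulf_eq0 negb_or => /andP[].
elim: r {qr qx iq} => [|z r IH]; first by rewrite !big_nil ComplexField.Normc.normc1 ln1.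
rewrite !big_cons mulf_eq0 negb_or => /andP[z0 /[dup] r0 /IH {}IH].
rewrite cmodM lnM ?posrE ?cmod_gt0// lerD// sub0r cmodN.
rewrite ler_ln ?posrE ?lt_max ?ltr01 ?cmod_gt0//; last by rewrite -oppr_eq0 -sub0r.
by rewrite le_max lexx orbT.
Qed.

(** A bound on the unit circle controls q everywhere: for each root z,
    |x - z| <= max (1, |z|) (1 + |x|), and by Jensen's inequality the product
    of |lead_coef q| and the max (1, |z|) is at most the geometric mean of |q|
    over the circle. *)
Lemma bernstein_walsh_disc q n x M : (size q <= n.+1)%N ->
  (forall t, cmod q.[cis t] <= expR M) ->
  cmod q.[x] <= expR (M + n%:R * ln (1 + cmod x)).
Proof.
move=> sq qM; have [->|q0] := eqVneq q 0.
  by rewrite horner0 ComplexField.Normc.normc0 expR_ge0.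
have lq : lead_coef q != 0 by rewrite lead_coef_eq0.
have [r qr] := closed_field_poly_normal q.
have sr : (size r <= n)%N.
  by move: sq; rewrite qr size_scale// size_prod_XsubC ltnS.
have qx y : q.[y] = lead_coef q * \prod_(z <- r) (y - z).
  rewrite {1}qr hornerZ horner_prod; congr (_ * _).
  by apply: eq_bigr => z _; rewrite hornerXsubC.
have [iq le_q] := jensen_prod (f := fun t => lne (cmod q.[cis t])%:E) lq
  (fun t => congr1 (fun x => lne (cmod x)%:E) (qx (cis t))).
have mD : measurable (D : set (measurableTypeR R)) by exact: measurable_itv.
have lM : ln (cmod (lead_coef q)) + \sum_(z <- r) ln (Num.max 1 (cmod z)) <= M.
  have : ((2 * pi * (ln (cmod (lead_coef q)) +
      \sum_(z <- r) ln (Num.max 1 (cmod z))))%:E <= (2 * pi * M)%:E)%E.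
    apply: le_trans le_q _.
    apply: (@le_trans _ _ (\int[mu]_(t in D) (cst M%:E) t)%E).
      apply: le_integral => //.
        by apply: continuous_integrable_itv => ?; exact: cvg_cst.
      move=> t _; rewrite /lne; case: ifPn => [_|]; first exact: leNye.
      by rewrite -ltNge => p; rewrite lee_fin -[M]expRK ler_ln// posrE expR_gt0.
    by rewrite integral_cst_circle.
  by rewrite lee_fin ler_pM2l// mulr_gt0 ?pi_gt0.
have x1 : 1 <= 1 + cmod x by rewrite lerDl cmod_ge0.
have max0 z : 0 < Num.max 1 (cmod z) :> R by rewrite lt_max ltr01.
apply: (@le_trans _ _ (expR (M + (size r)%:R * ln (1 + cmod x)))); last first.
  by rewrite ler_expR lerD2l ler_wpM2r ?ler_nat// ln_ge0.
apply: (@le_trans _ _ (expR (ln (cmod (lead_coef q)) +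
    \sum_(z <- r) ln (Num.max 1 (cmod z)) + (size r)%:R * ln (1 + cmod x)))); last first.
  by rewrite ler_expR lerD2r.
rewrite expRD expRD lnK ?posrE ?cmod_gt0// qx cmodM -mulrA ler_pM2l ?cmod_gt0//.
elim: r {qr qx sr iq le_q lM} => [|z r IH].
  by rewrite !big_nil mul0r expR0 mulr1 ComplexField.Normc.normc1.
rewrite !big_cons cmodM expRD lnK ?posrE//= -natr1 mulrDl mul1r expRD lnK ?posrE ?(lt_le_trans _ x1)//.
rewrite [leRHS](_ : _ = (Num.max 1 (cmod z) * (1 + cmod x)) *
  (expR (\sum_(j <- r) ln (Num.max 1 (cmod j))) *
   expR ((size r)%:R * ln (1 + cmod x)))); last by ring.
apply: ler_pM => //; rewrite ?cmod_ge0//.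
apply: (le_trans (cmodD x (- z))); rewrite cmodN mulrDr mulr1 addrC lerD//.
  by rewrite le_max lexx orbT.
by rewrite ler_peMl ?cmod_ge0// le_max lexx.
Qed.
End jensen_horner.

(** * Topology of C^d and logarithmic potentials of polynomials *)

Section Cd_topology.
Context {R : realType} {d : nat}.
Local Notation Cd := 'rV[R[i]]_d.

Lemma cmod_ltP (x : R[i]) (e : R) : (`|x| < e%:C) = (cmod x < e).
Proof. by rewrite -ltcR; case: x. Qed.

Lemma ballCP (x y : R[i]) (e : R) : ball x e%:C y = (cmod (y - x) < e) :> Prop.
Proof. rewrite cmodB -cmod_ltP. rewrite -ball_normE; reflexivity. Qed.

Lemma gt0_real_complex (e : R[i]) : 0 < e -> e = (complex.Re e)%:C.
Proof. by case: e => a b; rewrite ltcE /= => /andP[/eqP -> _]. Qed.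

(** Neighbourhoods described with real radii, since the radii of the
    topology of C^d are themselves complex numbers. *)
Lemma nbhs_CdP (z : Cd) (A : set Cd) : nbhs z A <->
  exists2 e : R, 0 < e & forall y : Cd, (forall k, cmod (y 0 k - z 0 k) < e) -> A y.
Proof.
split=> [/nbhs_ballP[e /= e0 eA]|[e e0 eA]].
  have er := gt0_real_complex e0.
  exists (complex.Re e); first by rewrite -ltcR -er.
  move=> y ye; apply: eA; split=> // i j; rewrite ord1 er ballCP; exact: ye.
apply/nbhs_ballP; exists e%:C => /=; first by rewrite ltcR.
by move=> y zy; apply: eA => k; rewrite -ballCP; exact: zy.2.
Qed.

Lemma continuous_cmod : continuous (fun x : R[i] => cmod x).
Proof.
move=> x; apply/(@cvgrPdist_lt _ _ _ (nbhs x) _) => e e0.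
apply/nbhs_ballP; exists e%:C => /=; first by rewrite ltcR.
move=> y; rewrite ballCP; apply: le_lt_trans.
rewrite ler_norml; apply/andP; split.
  by rewrite lerBrDl addrC -lerBrDl opprK; have := cmodD (y - x) x; rewrite subrK addrC.
by rewrite lerBlDr; have := cmodD (x - y) y; rewrite subrK cmodB.
Qed.

Lemma continuous_peval (q : mpoly.mpoly d R[i]) : continuous (fun z : Cd => peval q z).
Proof.
rewrite /peval; under eq_fun do rewrite mpoly.mevalE.
have ca : continuous (fun x : R[i] * R[i] => x.1 + x.2).
  by move=> x; apply: (@cvgD R[i] R[i]); [exact: cvg_fst|exact: cvg_snd].
have cm : continuous (fun x : R[i] * R[i] => x.1 * x.2).
  by move=> x; apply: (@cvgM R[i]); [exact: cvg_fst|exact: cvg_snd].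
have cX n : continuous (fun x : R[i] => x ^+ n).
  elim: n => [|n IH] z.
    have -> : (fun x : R[i] => x ^+ 0) = cst 1 by apply/funext => x; rewrite expr0.
    exact: cst_continuous.
  have -> : (fun x : R[i] => x ^+ n.+1) = (fun x => x * x ^+ n).
    by apply/funext => x; rewrite exprS.
  by apply: (@cvgM R[i] _ (nbhs z) _); [exact: cvg_id|exact: IH].
apply: (@continuous_big R[i] _ _ _ _ ca) => m _ z.
apply: (@cvgM R[i] _ (nbhs z) _). exact: cvg_cst.
apply: (@cvg_big R[i] _ _ _ _ cm) => k _.
apply: (@continuous_comp _ _ _ (fun x : Cd => x 0 k) (fun x : R[i] => x ^+ m k)).
  exact: (@coord_continuous R[i]).
exact: cX.
Qed.

Lemma continuous_cmod_peval (q : mpoly.mpoly d R[i]) :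
  continuous (fun z : Cd => cmod (peval q z)).
Proof.
by move=> z; apply: continuous_comp; [exact: continuous_peval|exact: continuous_cmod].
Qed.
End Cd_topology.

Section poly_lines.
Context {R : realType} {d : nat}.
Local Notation Cd := 'rV[R[i]]_d.
Implicit Types (q : mpoly.mpoly d R[i]) (z v : Cd).

(** Restriction to a complex line, which reduces statements on C^d to
    polynomials in one variable. *)
Lemma peval_line q n z v : poly_le n q -> exists2 Q : {poly R[i]},
  (size Q <= n.+1)%N & forall x, Q.[x] = peval q (z + x *: v).
Proof.
move=> qn.
exists (\sum_(m <- mpoly.msupp q) mpoly.mcoeff m q *:
  \prod_(k < d) ((z 0 k)%:P + v 0 k *: 'X) ^+ m k); last first.
  move=> x; rewrite horner_sum /peval mpoly.mevalE; apply: eq_bigr => m _.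
  rewrite hornerZ horner_prod; congr (_ * _); apply: eq_bigr => k _.
  by rewrite horner_exp !hornerE !mxE mulrC.
apply: (leq_trans (size_sum _ _ _)).
rewrite big_seq; elim/big_ind: _ => // [a b an bn|m mq]; first by rewrite geq_max an.
apply: (leq_trans (size_scale_leq _ _)).
apply: (leq_trans (size_prod_leq _ _)).
apply: (@leq_trans (mpoly.mdeg m).+1); last first.
  exact: leq_trans (mpoly.msize_mdeg_lt mq) qn.
rewrite leq_subLR mpoly.mdegE addnS ltnS -sum1_card -big_split /=.
apply: leq_sum => k _; apply: (leq_trans (size_poly_exp_leq _ _)).
rewrite add1n ltnS -[leqRHS]mul1n leq_mul2r; apply/orP; right.
rewrite -ltnS; case: (size _) (size_polyD (z 0 k)%:P (v 0 k *: 'X)) => // s.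
rewrite /= => /leq_trans; apply; rewrite geq_max; apply/andP; split.
  by rewrite (leq_trans (size_polyC_leq1 _)).
by rewrite (leq_trans (size_scale_leq _ _))// size_polyX.
Qed.

Lemma cmod_le_enorm z k : cmod (z 0 k) <= enorm z.
Proof.
rewrite -[leLHS]ger0_norm ?cmod_ge0// -sqrtr_sqr ler_wsqrtr//.
by rewrite (bigD1 k)//= lerDl sumr_ge0// => i _; rewrite sqr_ge0.
Qed.

Lemma peval_growth q n : poly_le n q -> exists2 C : R, 0 < C &
  forall z, 1 <= enorm z -> cmod (peval q z) <= C * enorm z ^+ n.
Proof.
move=> qn.
exists (1 + \sum_(m <- mpoly.msupp q) cmod (mpoly.mcoeff m q)).
  by rewrite ltr_pwDl// sumr_ge0// => m _; exact: cmod_ge0.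
move=> z z1; rewrite mulrDl mul1r -[leLHS]add0r lerD ?exprn_ge0 ?(le_trans ler01)//.
rewrite /peval mpoly.mevalE (le_trans (cmod_sum_le _ _ _))// mulr_suml.
rewrite big_seq [leRHS]big_seq; apply: ler_sum => m mq.
rewrite cmodM ler_wpM2l ?cmod_ge0// cmod_prod.
apply: (@le_trans _ _ (enorm z ^+ mpoly.mdeg m)); last first.
  by apply: ler_weXn2l => //; rewrite -ltnS; exact: leq_trans (mpoly.msize_mdeg_lt mq) qn.
rewrite mpoly.mdegE -prodrXr; apply: ler_prod => k _.
rewrite cmodX exprn_ge0 ?cmod_ge0//=.
by rewrite lerXn2r ?nnegrE ?cmod_ge0 ?(le_trans ler01)// cmod_le_enorm.
Qed.

Local Notation mu := (@lebesgue_measure R).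

Definition log_peval n q z : \bar R := ((n%:R^-1)%:E * lne (cmod (peval q z))%:E)%E.

Lemma log_peval_lty n q z : (log_peval n q z < +oo)%E.
Proof.
rewrite /log_peval /lne; case: ifP => _; last by rewrite -EFinM ltry.
rewrite -[(n%:R^-1)%:E]gee0_abs ?lee_fin ?invr_ge0//.
have [->|n0] := eqVneq n 0%N; first by rewrite invr0 abse0 mul0e.
by rewrite gt0_muleNy// gee0_abs ?lee_fin ?lte_fin ?invr_gt0 ?invr_ge0// ltr0n lt0n.
Qed.

(** Comparisons with a potential, freed of the value -oo at zeros. *)
Lemma log_peval_leP n q z (M : R) : (0 < n)%N ->
  (log_peval n q z <= M%:E)%E = (cmod (peval q z) <= expR (n%:R * M)).
Proof.
move=> n0; have n0' : 0 < n%:R :> R by rewrite ltr0n.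
rewrite /log_peval /lne; case: ifPn => [c0|].
  rewrite gt0_muleNy ?lte_fin ?invr_gt0// leNye; apply/esym.
  exact: le_trans c0 (expR_ge0 _).
rewrite -ltNge => c0; rewrite -EFinM lee_fin ler_pdivrMl//.
by rewrite -[RHS]ler_ln ?posrE ?expR_gt0// expRK.
Qed.

Lemma log_peval_ltP n q z (M : R) : (0 < n)%N ->
  (log_peval n q z < M%:E)%E = (cmod (peval q z) < expR (n%:R * M)).
Proof.
move=> n0; have n0' : 0 < n%:R :> R by rewrite ltr0n.
rewrite /log_peval /lne; case: ifPn => [c0|].
  rewrite gt0_muleNy ?lte_fin ?invr_gt0// ltNye; apply/esym.
  exact: le_lt_trans c0 (expR_gt0 _).
rewrite -ltNge => c0; rewrite -EFinM lte_fin ltr_pdivrMl//.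
by rewrite -[RHS]ltr_ln ?posrE ?expR_gt0// expRK.
Qed.

Lemma log_peval_submean n q z v : (0 < n)%N ->
  (log_peval n q z <= ((2 * pi)^-1)%:E *
     \int[mu]_(t in `[0%R, (2 * pi)%R]) log_peval n q (z + cis t *: v)%R)%E.
Proof.
move=> n0; have n0' : 0 < n%:R^-1 :> R by rewrite invr_gt0 ltr0n.
have [Q _ QE] := @peval_line q (mpoly.msize q) z v (leqnSn _).
have [q0|q0] := eqVneq (peval q z) 0.
  by rewrite /log_peval q0 ComplexField.Normc.normc0 le0_lneNy// gt0_muleNy ?lte_fin// leNye.
have Q0 : Q.[0] != 0 by rewrite QE scale0r addr0.
have [iQ leQ] := jensen_horner Q0.
rewrite /log_peval; under eq_integral do rewrite -QE.
rewrite integralZl//.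
rewrite lne_EFin ?cmod_gt0//.
apply: (@le_trans _ _ (((2 * pi)^-1)%:E * ((n%:R^-1)%:E * (2 * pi * ln (cmod Q.[0]))%:E))%E).
  rewrite -!EFinM lee_fin QE scale0r addr0 mulrCA mulKf// mulf_neq0//.
  by rewrite gt_eqF// pi_gt0.
by rewrite !lee_wpmul2l// lee_fin ?invr_ge0 ?mulr_ge0 ?pi_ge0// ltW.
Qed.

(** Potentials of polynomials of degree at most n are competitors in the
    definition of the extremal function. *)
Lemma log_peval_lelong n q : (0 < n)%N -> poly_le n q -> lelong (log_peval n q).
Proof.
move=> n0 qn; have n0' : 0 < n%:R :> R by rewrite ltr0n.
split; first split.
- by move=> z; exact: log_peval_lty.
- move=> z a; rewrite lteNr log_peval_ltP// => az.
  exists [set y | cmod (peval q y) < expR (n%:R * - a)]; last first.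
    by move=> y; rewrite /= -log_peval_ltP// lteNr.
  apply: (@continuous_cmod_peval R d q z [set r | r < expR (n%:R * - a)]).
  by apply: open_nbhs_nbhs; split; [exact: open_lt|exact: az].
- by move=> z v; exact: log_peval_submean.
have [C C0 Cq] := peval_growth qn.
exists (ln C / n%:R), 1; split=> // z z1; rewrite log_peval_leP//.
have z0 : 0 < enorm z by exact: lt_le_trans z1.
rewrite mulrDr mulrCA divff ?gt_eqF// mulr1 expRD (lnK C0) expRM_natl lnK ?posrE//.
by rewrite mulrC Cq.
Qed.

End poly_lines.

(** * Dimension of the polynomial spaces and the extremal function *)

Section dimension.
Context {R : realType} {d : nat}.

(** Monomials of degree at most n are indexed by functions from d variables
    to {0, ..., n}, and the coefficient matrix of a free family has
    independent rows. *)
Lemma basis_poly_le_card n M (e : nat -> mpoly.mpoly d R[i]) :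
  is_basis (poly_le n) M e -> (M <= n.+1 ^ d)%N.
Proof.
move=> [eP eind _].
pose T := {ffun 'I_d -> 'I_n.+1}.
pose mon (f : T) : mpoly.multinom d := 
  mpoly.Multinom [tuple (f k : nat) | k < d].
pose A : 'M[R[i]]_(M, #|{: T}|) :=
  \matrix_(i, j) mpoly.mcoeff (mon (enum_val j)) (e i).
suff : row_free A.
  by move=> /eqP <-; apply: leq_trans (rank_leq_col _) _; rewrite card_ffun !card_ord.
rewrite -kermx_eq0; apply/rowV0P => u /sub_kermxP uA.
pose c (j : nat) : R[i] := if insub j is Some i then u 0 i else 0.
have cE (i : 'I_M) : c i = u 0 i by rewrite /c valK.
have ce0 : \sum_(j < M) c j *: e j = 0.
  apply/mpoly.mpolyP => m; rewrite mpoly.mcoeff0 raddf_sum /=.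
  under eq_bigr do rewrite mpoly.mcoeffZ cE.
  have [mn|mn] := leqP (mpoly.mdeg m) n; last first.
    rewrite big1// => j _; have [/mpoly.msize_mdeg_lt mj|] := boolP (m \in mpoly.msupp (e j)).
      by have := leq_trans mj (eP j (ltn_ord j)); rewrite ltnS leqNgt mn.
    by rewrite -mpoly.mcoeff_eq0 => /eqP ->; rewrite mulr0.
  have mk k : (m k < n.+1)%N.
    by rewrite ltnS; apply: leq_trans mn; rewrite mpoly.mdegE (bigD1 k)//= leq_addr.
  pose f : T := [ffun k => Ordinal (mk k)].
  have fm : mon f = m by apply/mpoly.mnmP => k; rewrite mpoly.mnm_tnth tnth_mktuple ffunE.
  move/matrixP: uA => /(_ 0 (enum_rank f)); rewrite !mxE => {2}<-.
  by apply: eq_bigr => j _; rewrite mxE enum_rankK fm.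
apply/rowP => j; rewrite mxE -cE; exact: eind ce0 _ (ltn_ord j).
Qed.
End dimension.

Section extremal.
Context {R : realType} {d : nat}.
Local Notation Cd := 'rV[R[i]]_d.
Implicit Types (K : set Cd) (q : mpoly.mpoly d R[i]) (z : Cd).

Lemma peval1 z : peval (1 : mpoly.mpoly d R[i]) z = 1.
Proof. exact: mpoly.meval1. Qed.

Lemma poly_le1 n : poly_le n (1 : mpoly.mpoly d R[i]).
Proof. by rewrite /poly_le /= mpoly.mmeasure1. Qed.

Lemma log_peval1 n z : log_peval n 1 z = 0%E.
Proof. by rewrite /log_peval peval1 ComplexField.Normc.normc1 lne1 mule0. Qed.

(** The potential is in the Lelong class and nonpositive on K, hence it
    competes in the supremum. *)
Lemma log_peval_le_extremal K n q z : (0 < n)%N -> poly_le n q ->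
  (sup_norm K q <= 1)%E -> (log_peval n q z <= extremal_fun K z)%E.
Proof.
move=> n0 qn qK; apply: ereal_sup_ubound; exists (log_peval n q) => //.
split; first exact: log_peval_lelong.
move=> x Kx; rewrite log_peval_leP// mulr0 expR0 -lee_fin.
by apply: le_trans qK; apply: ereal_sup_ubound; exists x.
Qed.

Lemma extremal_ge0 K z : (0 <= extremal_fun K z)%E.
Proof.
rewrite -(log_peval1 1 z); apply: log_peval_le_extremal => //; first exact: poly_le1.
by apply: ub_ereal_sup => _ [x _ <-]; rewrite peval1 ComplexField.Normc.normc1.
Qed.

Lemma extremal_le0 K z : K z -> (extremal_fun K z <= 0)%E.
Proof. by move=> Kz; apply: ub_ereal_sup => _ [u [_ uK] <-]; exact: uK. Qed.

(** The empty set is pluripolar, as the constant 0 shows. *)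
Lemma nonpluripolar_nonempty K : ~ pluripolar K -> exists z, K z.
Proof.
move=> np; apply: contrapT => K0; apply: np.
have [ppsh _] := @log_peval_lelong R d 1 1 isT (poly_le1 1).
exists (log_peval 1 1); split=> //; first by exists 0; rewrite log_peval1.
by move=> z Kz; case: K0; exists z.
Qed.

(** Bernstein-Walsh on a polydisc: restrict to the line through x0 and z,
    scaled so that the unit circle of the parameter lies in the small polydisc. *)
Lemma peval_le_ball q n (x0 z : Cd) (e : R) : 0 < e -> (0 < n)%N -> poly_le n q ->
  (forall y : Cd, (forall k, cmod (y 0 k - x0 0 k) < e) -> cmod (peval q y) <= expR n%:R) ->
  forall r : R, 0 < r -> (forall k, cmod (z 0 k - x0 0 k) <= r) ->
  cmod (peval q z) <= expR (n%:R * (1 + ln (1 + 2 * r / e))).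
Proof.
move=> e0 n0 qn qball r r0 zr.
pose l : R := e / (2 * r).
have l0 : 0 < l by rewrite divr_gt0 ?mulr_gt0.
have [Q sQ QE] := peval_line x0 (l%:C *: (z - x0)) qn.
have lC : l%:C != 0 by rewrite eq_complex /= gt_eqF.
have cl : cmod (l%:C) = l by rewrite /= expr0n addr0 sqrtr_sqr gtr0_norm.
have -> : peval q z = Q.[(l%:C)^-1].
  by rewrite QE scalerA mulVf// scale1r addrC subrK.
apply: le_trans (@bernstein_walsh_disc _ Q n _ n%:R sQ _) _.
  move=> t; rewrite QE; apply: qball => k.
  rewrite !mxE addrAC subrr add0r mulrA cmodM cmodM cmod_cis mul1r cl.
  apply: le_lt_trans (_ : l * r < _); first by rewrite ler_pM2l// zr.
  by rewrite /l invfM mulrA mulfVK ?gt_eqF// ltr_pdivrMr// ltr_pMr// ltr1n.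
rewrite ler_expR mulrDr mulr1 ComplexField.Normc.normcV cl /l invf_div.
by rewrite lexx.
Qed.

Lemma basis_poly_le_gt0 n M (e : nat -> mpoly.mpoly d R[i]) :
  is_basis (poly_le n) M e -> (0 < M)%N.
Proof.
case: M => // -[_ _ /(_ 1 (poly_le1 n))[c]]; rewrite big_ord0 => /eqP.
by rewrite oner_eq0.
Qed.

Lemma within_infinite_proper (Y : set nat) : infinite_set Y ->
  ProperFilter (within Y \oo).
Proof.
move=> Yoo; apply: Build_ProperFilter_ex => B [N _ NB]; apply: contrapT => B0.
apply: Yoo; apply: (@sub_finite_set _ _ `I_N) (finite_II N) => n Yn /=.
rewrite ltnNge; apply/negP => Nn; apply: B0; exists n; exact: NB.
Qed.

Lemma Bfun_ge1 m (p : nat -> nat -> mpoly.mpoly d R[i]) n z :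
  (0 < m n)%N -> p n 0%N = 1 -> 1 <= Bfun m p n z.
Proof.
rewrite /Bfun; case: (m n) => // k _ p1.
rewrite big_ord_recl /= p1 peval1 ComplexField.Normc.normc1 expr1n lerDl.
by rewrite sumr_ge0// => i _; rewrite sqr_ge0.
Qed.

Lemma ln_basis_card n M (e : nat -> mpoly.mpoly d R[i]) :
  is_basis (poly_le n) M e -> ln (M%:R : R) <= d%:R * ln n.+1%:R.
Proof.
move=> be; have M0 := basis_poly_le_gt0 be.
rewrite mulr_natl -lnXn// -natrX ler_ln ?posrE ?ltr0n ?expn_gt0//.
by rewrite ler_nat; exact: basis_poly_le_card be.
Qed.

(** Near a point of K the extremal function is at most 1 by continuity, so
    Bernstein-Walsh bounds the potentials of B_n uniformly on bounded sets.
    At the points w_r the limits of these potentials are the values of the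
    extremal function, and an infinite value at z would, by continuity,
    violate the bound at some w_r close to z. *)
Lemma extremal_fun_lty K m (p : nat -> nat -> mpoly.mpoly d R[i])
    (Y : set nat) (w : nat -> Cd) : regular_set K ->
  (forall n, (0 < n)%N -> is_basis (poly_le n) (m n) (p n)) ->
  (forall n, (0 < n)%N -> p n 0%N = 1) ->
  (forall n j, array_index m (n, j) -> (sup_norm K (p n j) <= 1)%E) ->
  infinite_set Y -> dense (range w) ->
  (forall r, ((2 * n%:R)^-1 * ln (Bfun m p n (w r)))%:E @[n --> within Y \oo]
        --> extremal_fun K (w r)) ->
  forall z, (extremal_fun K z < +oo)%E.
Proof.
move=> [Knp Kc] pb p1 pn Yoo wd wl z.
have FY := within_infinite_proper Yoo.
have [x0 Kx0] := nonpluripolar_nonempty Knp.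
have : nbhs x0 [set y | (extremal_fun K y < 1)%E].
  apply: (Kc x0 [set x : \bar R | (x < 1)%E]); apply: open_nbhs_nbhs; split.
    exact: open_ereal_lt_ereal.
  by rewrite /=; apply: le_lt_trans (extremal_le0 Kx0) _; rewrite lte_fin.
move=> /nbhs_CdP[e e0 eV].
rewrite ltNge leye_eq; apply/negP => /eqP Vz.
pose r : R := 1 + \sum_(k < d) cmod (z 0 k - x0 0 k).
have r0 : 0 < r by rewrite ltr_pwDl// sumr_ge0// => k _; exact: cmod_ge0.
(* The Bernstein-Walsh bound, uniform on the unit polydisc around z; the
   extra d in C0 + d absorbs log(m_n) / (2 n). *)
pose C0 := 1 + ln (1 + 2 * r / e).
have : nbhs z [set y | ((C0 + d%:R)%:E < extremal_fun K y)%E].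
  apply: (Kc z [set x : \bar R | ((C0 + d%:R)%:E < x)%E]); apply: open_nbhs_nbhs; split.
    exact: open_ereal_gt_ereal.
  by rewrite /= Vz ltry.
move=> /nbhs_CdP[e' e'0 e'V].
pose e'' := Num.min e' 1.
pose U := [set y : Cd | nbhs y [set y : Cd | forall k, cmod (y 0 k - z 0 k) < e'']].
have zU : U z.
  apply/nbhs_CdP; exists e'' => //; by rewrite lt_min e'0 ltr01.
have oU : open U by rewrite openE => y Uy; exact: nbhs_interior Uy.
have [y [Uy [n0 _ wy]]] := wd U (ex_intro _ z zU) oU.
have {U oU zU}Uy := nbhs_singleton Uy.
have Vy : ((C0 + d%:R)%:E < extremal_fun K y)%E.
  by apply: e'V => k; apply: lt_le_trans (Uy k) _; rewrite ge_min lexx.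
suff : (extremal_fun K y <= (C0 + d%:R)%:E)%E by rewrite leNgt Vy.
rewrite -wy; apply: (cvge_le _ (wl n0)).
exists 1%N => // n /= n1 _; rewrite lee_fin wy.
have n0' : 0 < n%:R :> R by rewrite ltr0n.
have yr k : cmod (y 0 k - x0 0 k) <= r.
  have -> : y 0 k - x0 0 k = (y 0 k - z 0 k) + (z 0 k - x0 0 k) by rewrite addrA subrK.
  apply: le_trans (cmodD _ _) _; apply: lerD.
    by apply/ltW; apply: lt_le_trans (Uy k) _; rewrite ge_min lexx orbT.
  by rewrite (bigD1 k)//= lerDl sumr_ge0// => i _; exact: cmod_ge0.
have py (j : 'I_(m n)) : cmod (peval (p n j) y) <= expR (n%:R * C0).
  have pj := pn n j (conj n1 (ltn_ord j)).
  have [bp _ _] := pb n n1.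
  apply: (peval_le_ball e0 n1 (bp _ (ltn_ord j)) _ r0 yr) => x xe.
  rewrite -[n%:R]mulr1 -log_peval_leP//; apply/ltW.
  apply: le_lt_trans (eV x xe); apply: log_peval_le_extremal => //.
  exact: bp (ltn_ord j).
have By : Bfun m p n y <= (m n)%:R * expR (n%:R * C0) ^+ 2.
  apply: (@le_trans _ _ (\sum_(j < m n) expR (n%:R * C0) ^+ 2)).
    apply: ler_sum => j _; rewrite lerXn2r ?nnegrE ?cmod_ge0 ?expR_ge0//; exact: py.
  by rewrite sumr_const card_ord -[leLHS]mulr_natl.
have m0 : (0 < m n)%N := basis_poly_le_gt0 (pb n n1).
have B1 := Bfun_ge1 y m0 (p1 n n1).
have lnB : ln (Bfun m p n y) <= ln (m n)%:R + 2 * (n%:R * C0).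
  have -> : 2 * (n%:R * C0) = ln (expR (n%:R * C0) ^+ 2).
    by rewrite lnXn ?expR_gt0// expRK mulr_natl.
  rewrite -lnM ?posrE ?ltr0n ?exprn_gt0 ?expR_gt0// ler_ln ?posrE ?(lt_le_trans ltr01 B1)//.
  by rewrite mulr_gt0 ?ltr0n ?exprn_gt0 ?expR_gt0.
rewrite ler_pdivrMl ?mulr_gt0//; apply: le_trans lnB _.
have : ln (m n)%:R <= d%:R * n%:R :> R.
  apply: le_trans (ln_basis_card (pb n n1)) _; rewrite ler_wpM2l//.
  by rewrite -natr1 addrC le_ln1Dx// (lt_le_trans _ (ler0n _ _))// ltrN10.
have : 0 <= d%:R * n%:R :> R by rewrite mulr_ge0.
have -> : 2 * n%:R * (C0 + d%:R) = 2 * (n%:R * C0) + 2 * (d%:R * n%:R) by ring.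
lra.
Qed.
End extremal.

(** * Product Lebesgue measure and shears *)

Section tuple_measure.
Context {R : realType}.
Local Notation mu := (@lebesgue_measure R).

Definition box n (c : 'I_n -> R) (r : R) : set (n.-tuple R) :=
  [set x | forall i, c i - r <= tnth x i <= c i + r].

Lemma measurable_box n (c : 'I_n -> R) r : measurable (box c r).
Proof.
have -> : box c r = \bigcap_(i in [set: 'I_n])
    ((fun x : n.-tuple R => tnth x i) @^-1` `[c i - r, c i + r]).
  apply/seteqP; split => x /= H i; last first.
    by have := H i Logic.I; rewrite /= in_itv.
  by rewrite /= in_itv; move=> _; exact: H.
apply: fin_bigcap_measurable => // i _.
rewrite -[X in measurable X]setTI; apply: measurable_tnth => //; exact: measurable_itv.
Qed.

Definition tcons n (p : n.-tuple R * R) : n.+1.-tuple R := [tuple of p.2 :: p.1].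

Lemma measurable_tcons n : measurable_fun setT (@tcons n).
Proof. exact: measurable_cons. Qed.

Lemma lebesgue_tuple_box n (c : 'I_n -> R) r : 0 <= r ->
  lebesgue_tuple n (box c r) = ((2 * r) ^+ n)%:E.
Proof.
move=> r0; elim: n c => [|n IH] c.
  rewrite expr0 /= diracE mem_set//; by case.
rewrite /= /cons_measure /pushforward.
have -> : (fun p : n.-tuple R * R => [the n.+1.-tuple R of p.2 :: p.1]) @^-1` box c r =
    box (fun i => c (lift ord0 i)) r `*` `[c ord0 - r, c ord0 + r]%classic.
  apply/seteqP; split => [[x y] /= H|[x y] /= [H1]].
    split; last by have := H ord0; rewrite tnth0 in_itv.
    by move=> i; have := H (lift ord0 i); rewrite tnthS.
  rewrite in_itv /= => H2 i; case: (unliftP ord0 i) => [j ->|->].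
    by rewrite tnthS; exact: H1.
  by rewrite tnth0.
rewrite product_measure1E//; last exact: measurable_box.
have := @lebesgue_measure_itv R `[c ord0 - r, c ord0 + r] => /= ->.
rewrite IH exprSr lte_fin; case: ifPn => [_|rr].
  by rewrite -EFinD -EFinM; congr (_ * _)%:E; ring.
have -> : r = 0 by apply/eqP; rewrite eq_le r0 andbT; move: rr; rewrite -leNgt; lra.
by rewrite mulr0 mulr0 mule0.
Qed.

Lemma lebesgue_tuple_sigma_finite n : sigma_finite setT (@lebesgue_tuple R n).
Proof.
exists (fun k => box (fun _ : 'I_n => 0) k%:R).
  apply/esym/seteqP; split=> // x _.
  pose M := \sum_(i < n) `|tnth x i|.
  exists (Num.Def.archi_bound M) => // i.
  rewrite sub0r add0r -ler_norml.
  have M0 : 0 <= M by apply: sumr_ge0.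
  apply: le_trans (ltW (archi_boundP M0)).
  by rewrite /M (bigD1 i)//= lerDl sumr_ge0.
move=> k; split; first exact: measurable_box.
by rewrite lebesgue_tuple_box// ltry.
Qed.

(** Naming the product measure lets it carry the sigma-finite structure that
    the Fubini-Tonelli theorem asks for. *)
Definition lebT n : set (n.-tuple R) -> \bar R := lebesgue_tuple n.
Arguments lebT : clear implicits.

HB.instance Definition _ n := isMeasure.Build _ _ _ (lebT n)
  (measure0 (lebesgue_tuple n)) (measure_ge0 (lebesgue_tuple n))
  (@measure_semi_sigma_additive _ _ _ (lebesgue_tuple n)).

HB.instance Definition _ n := @Measure_isSigmaFinite.Build _ _ _ (lebT n)
  (@lebesgue_tuple_sigma_finite n).

Local Open Scope ereal_scope.

(** The recursive definition of the product measure, as an iterated integral. *)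
Lemma integral_lebT_cons n (g : n.+1.-tuple R -> \bar R) :
  measurable_fun setT g -> (forall x, 0 <= g x) ->
  \int[lebT n.+1]_x g x = \int[lebT n]_x \int[mu]_y g (tcons (x, y)).
Proof.
move=> mg g0.
transitivity (\int[pushforward (lebT n \x mu) (@tcons n)]_x g x).
  by apply: eq_measure_integral => [|ms A mA _ //]; exact: measurable_tcons.
rewrite ge0_integral_pushforward//; last exact: measurable_tcons.
rewrite preimage_setT.
have mgt := measurableT_comp mg (@measurable_tcons n).
exact: (@fubini_tonelli1 _ _ _ _ R (lebT n) mu (g \o @tcons n) mgt (fun p => g0 _)).
Qed.

Definition upd n (x : n.-tuple R) (i : 'I_n) (y : R) : n.-tuple R :=
  [tuple if k == i then y else tnth x k | k < n].

Lemma tnth_upd n (x : n.-tuple R) i y k :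
  tnth (upd x i y) k = if k == i then y else tnth x k.
Proof. by rewrite tnth_mktuple. Qed.

Definition volume_preserving n (T : n.-tuple R -> n.-tuple R) : Prop :=
  measurable_fun setT T /\
  forall g : n.-tuple R -> \bar R, measurable_fun setT g -> (forall x, 0 <= g x) ->
    \int[lebT n]_x g (T x) = \int[lebT n]_x g x.

Lemma volume_preserving_comp n (S T : n.-tuple R -> n.-tuple R) :
  volume_preserving S -> volume_preserving T -> volume_preserving (S \o T).
Proof.
move=> [mS iS] [mT iT]; split; first exact: measurableT_comp mS mT.
by move=> g mg g0 /=; rewrite (iT (g \o S))//= ?iS//; exact: measurableT_comp mg mS.
Qed.

Lemma volume_preserving_id n : volume_preserving (@id (n.-tuple R)).
Proof. by split; [exact: measurable_id|]. Qed.

Lemma measurable_shear n (i : 'I_n) (h : n.-tuple R -> R) : measurable_fun setT h ->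
  measurable_fun setT (fun x => upd x i (tnth x i + h x)%R).
Proof.
move=> mh; apply/measurable_fun_tnthP => k.
have -> : (tnth (T:=R))^~ k \o (fun x => upd x i (tnth x i + h x)%R) =
    (fun x : n.-tuple R => (if k == i then tnth x i + h x else tnth x k)%R).
  by apply/funext => x /=; rewrite tnth_upd.
case: eqP => _; last exact: measurable_tnth.
by apply: measurable_funD => //; exact: measurable_tnth.
Qed.

(** By Fubini, a shear is a translation of one coordinate with the others
    frozen. *)
Lemma volume_preserving_shear n (i : 'I_n) (h : n.-tuple R -> R) :
  measurable_fun setT h -> (forall x y, h (upd x i y) = h x) ->
  volume_preserving (fun x => upd x i (tnth x i + h x)%R).
Proof.
elim: n i h => [|n IH] i h mh hi; first by have := ltn_ord i.
split; first exact: measurable_shear.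
move=> g mg g0.
have mT := @measurable_shear _ i h mh.
rewrite integral_lebT_cons; [|exact: measurableT_comp mg mT|by []].
rewrite [RHS]integral_lebT_cons//.
move: hi mT; case: (unliftP ord0 i) => [j ->|->] hi mT.
  pose hy y (x : n.-tuple R) := h (tcons (x, y)).
  have mhy y : measurable_fun setT (hy y).
    apply: (measurableT_comp mh); apply: (measurableT_comp (@measurable_tcons n)).
    exact: pair2_measurable.
  have updS x y z : upd (tcons (x, y)) (lift ord0 j) z = tcons (upd x j z, y).
    apply: eq_from_tnth => k; rewrite tnth_upd.
    case: (unliftP ord0 k) => [l ->|->].
      by rewrite !tnthS tnth_upd (inj_eq lift_inj).
    by rewrite !tnth0 (negbTE (neq_lift _ _)).
  pose G1 (p : n.-tuple R * R) := g (upd (tcons p) (lift ord0 j)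
    (tnth (tcons p) (lift ord0 j) + h (tcons p))%R).
  have mG1 : measurable_fun setT G1.
    apply: (measurableT_comp mg); apply: (measurableT_comp mT).
    exact: measurable_tcons.
  have mG2 := measurableT_comp mg (@measurable_tcons n).
  have e1 := @fubini_tonelli _ _ _ _ R (lebT n) mu G1 mG1 (fun p => g0 _).
  have e2 := @fubini_tonelli _ _ _ _ R (lebT n) mu _ mG2 (fun p => g0 _).
  etransitivity; first exact: e1.
  etransitivity; last exact: esym e2.
  apply: eq_integral => y _.
  have [_ ihy] := IH j (hy y) (mhy y) (fun x z => etrans (congr1 h (esym (updS x y z))) (hi _ _)).
  rewrite -(ihy (fun x => g (tcons (x, y))))//; last first.
    apply: (measurableT_comp mg); apply: (measurableT_comp (@measurable_tcons n)).
    exact: pair2_measurable.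
  by apply: eq_integral => x _; rewrite /G1 updS tnthS.
apply: eq_integral => x _.
have h0 y : h (tcons (x, y)) = h (tcons (x, 0%R)).
  rewrite -(hi (tcons (x, 0%R)) y); congr h; apply: eq_from_tnth => k.
  rewrite tnth_upd; case: (unliftP ord0 k) => [l ->|->].
    by rewrite !tnthS eq_sym (negbTE (neq_lift _ _)).
  by rewrite eqxx tnth0.
have updE y z : upd (tcons (x, y)) ord0 z = tcons (x, z).
  apply: eq_from_tnth => k; rewrite tnth_upd; case: (unliftP ord0 k) => [l ->|->].
    by rewrite !tnthS eq_sym (negbTE (neq_lift _ _)).
  by rewrite eqxx tnth0.
under eq_integral do rewrite updE tnth0 h0.
apply: (ge0_integral_shift (h (tcons (x, 0%R))) (f := fun y => g (tcons (x, y)))) => //.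
apply: (measurableT_comp mg); apply: (measurableT_comp (@measurable_tcons n)).
exact: pair1_measurable.
Qed.

End tuple_measure.
Arguments lebT {R} n _.

(** * Rotations and volume averages *)

Section rotations.
Context {R : realType} {d : nat}.
Local Notation mu := (@lebesgue_measure R).
Local Notation D := (`[0, 2 * pi]%classic : set R).
Local Notation tupd := ((d + d).-tuple R).
Implicit Types (x : tupd) (a b c t : R).

(** Simultaneous shears of the coordinates u k along the coordinates v k,
    centred at x0. *)
Definition block_shear (u v : 'I_d -> 'I_(d + d)) (x0 : tupd) c (s : seq 'I_d) x : tupd :=
  [tuple tnth x i + c * \sum_(k <- s | u k == i) (tnth x (v k) - tnth x0 (v k)) | i < d + d].

Lemma volume_preserving_block_shear u v x0 c s : (forall k l, u k != v l) ->
  volume_preserving (block_shear u v x0 c s).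
Proof.
move=> uv; elim: s => [|k s IH].
  have -> : block_shear u v x0 c [::] = id.
    by apply/funext => x; apply: eq_from_tnth => i; rewrite tnth_mktuple big_nil mulr0 addr0.
  exact: volume_preserving_id.
pose h x := c * (tnth x (v k) - tnth x0 (v k)).
have -> : block_shear u v x0 c (k :: s) =
    (fun x : tupd => upd x (u k) (tnth x (u k) + h x)) \o block_shear u v x0 c s.
  apply/funext => x; apply: eq_from_tnth => i /=.
  rewrite tnth_upd /h !tnth_mktuple big_cons.
  have -> : \sum_(l <- s | u l == v k) (tnth x (v l) - tnth x0 (v l)) = 0.
    by rewrite big_pred0// => l; exact: negbTE.
  rewrite mulr0 addr0 eq_sym; case: eqP => [->|_] //.
  by rewrite mulrDr addrAC -!addrA; congr (_ + _); rewrite addrC.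
apply: volume_preserving_comp IH; apply: volume_preserving_shear.
  apply: measurable_funM => //; apply: measurable_funB => //.
  exact: measurable_tnth.
by move=> x y; rewrite /h tnth_upd eq_sym (negbTE (uv _ _)).
Qed.

(** The rotation about x0 that multiplies by a + i b in every complex
    coordinate. *)
Definition rot (x0 : tupd) a b x : tupd := [tuple match fintype.split i with
  | inl k => tnth x0 i + (a * (tnth x (lshift d k) - tnth x0 (lshift d k)) -
      b * (tnth x (rshift d k) - tnth x0 (rshift d k)))
  | inr k => tnth x0 i + (b * (tnth x (lshift d k) - tnth x0 (lshift d k)) +
      a * (tnth x (rshift d k) - tnth x0 (rshift d k)))
  end | i < d + d].

Lemma tnth_rot_lshift x0 a b x k : tnth (rot x0 a b x) (lshift d k) =
  tnth x0 (lshift d k) + (a * (tnth x (lshift d k) - tnth x0 (lshift d k)) -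
      b * (tnth x (rshift d k) - tnth x0 (rshift d k))).
Proof. by rewrite tnth_mktuple (unsplitK (inl k)). Qed.

Lemma tnth_rot_rshift x0 a b x k : tnth (rot x0 a b x) (rshift d k) =
  tnth x0 (rshift d k) + (b * (tnth x (lshift d k) - tnth x0 (lshift d k)) +
      a * (tnth x (rshift d k) - tnth x0 (rshift d k))).
Proof. by rewrite tnth_mktuple (unsplitK (inr k)). Qed.

Lemma eq_tuple_halves x y : (forall k, tnth x (lshift d k) = tnth y (lshift d k)) ->
  (forall k, tnth x (rshift d k) = tnth y (rshift d k)) -> x = y.
Proof.
move=> xl xr; apply: eq_from_tnth => i.
by rewrite -(splitK i); case: (fintype.split i) => k; [exact: xl|exact: xr].
Qed.

Let X (x0 : tupd) c := block_shear (@lshift d d) (@rshift d d) x0 c (index_enum 'I_d).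
Let Y (x0 : tupd) c := block_shear (@rshift d d) (@lshift d d) x0 c (index_enum 'I_d).

Let XE x0 c x k : (tnth (X x0 c x) (lshift d k) =
    tnth x (lshift d k) + c * (tnth x (rshift d k) - tnth x0 (rshift d k))) *
  (tnth (X x0 c x) (rshift d k) = tnth x (rshift d k)).
Proof.
split; rewrite tnth_mktuple.
  by rewrite (big_pred1 k)// => l; rewrite (inj_eq (@lshift_inj _ _)).
by rewrite big_pred0 ?mulr0 ?addr0// => l; rewrite eq_lrshift.
Qed.

Let YE x0 c x k : (tnth (Y x0 c x) (rshift d k) =
    tnth x (rshift d k) + c * (tnth x (lshift d k) - tnth x0 (lshift d k))) *
  (tnth (Y x0 c x) (lshift d k) = tnth x (lshift d k)).
Proof.
split; rewrite tnth_mktuple.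
  by rewrite (big_pred1 k)// => l; rewrite (inj_eq (@rshift_inj _ _)).
by rewrite big_pred0 ?mulr0 ?addr0// => l; rewrite eq_rlshift.
Qed.

(** A rotation is the composition of three shears, except for the half turn,
    which is the square of a quarter turn. *)
Lemma volume_preserving_rot x0 a b : a ^+ 2 + b ^+ 2 = 1 ->
  volume_preserving (rot x0 a b).
Proof.
have Xvp c : volume_preserving (X x0 c).
  by apply: volume_preserving_block_shear => k l; rewrite eq_lrshift.
have Yvp c : volume_preserving (Y x0 c).
  by apply: volume_preserving_block_shear => k l; rewrite eq_rlshift.
(* The parameter (a - 1) / b is the tangent of minus half the angle. *)
have gen a' b' : b' != 0 -> a' ^+ 2 + b' ^+ 2 = 1 -> volume_preserving (rot x0 a' b').
  move=> b0 ab.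
  have -> : rot x0 a' b' = X x0 ((a' - 1) / b') \o (Y x0 b' \o X x0 ((a' - 1) / b')).
    apply/funext => x; apply: eq_tuple_halves => k;
      rewrite ?(tnth_rot_lshift, tnth_rot_rshift)/= !XE !YE !XE.
      have bE : b' = (1 - a' ^+ 2) / b' by apply: (mulIf b0); rewrite divfK// -ab; ring.
      rewrite {1}bE; field; exact: b0.
    by field.
  by do 2 (apply: volume_preserving_comp => //).
have [->|b0] := eqVneq b 0; last exact: gen.
rewrite expr0n addr0 => /eqP; rewrite sqrf_eq1 => /orP[]/eqP ->.
  have -> : rot x0 1 0 = id; last exact: volume_preserving_id.
  by apply/funext => x; apply: eq_tuple_halves => k;
    rewrite ?(tnth_rot_lshift, tnth_rot_rshift)/=; ring.
have -> : rot x0 (-1) 0 = rot x0 0 1 \o rot x0 0 1.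
  by apply/funext => x; apply: eq_tuple_halves => k;
    rewrite /= ?(tnth_rot_lshift, tnth_rot_rshift) ?(tnth_rot_lshift, tnth_rot_rshift)/=; ring.
have g1 : volume_preserving (rot x0 0 1) by apply: gen; rewrite ?oner_neq0//; ring.
exact: volume_preserving_comp.
Qed.

Lemma Cd_of_tuple_rot x0 t x : Cd_of_tuple (rot x0 (cos t) (sin t) x) =
  Cd_of_tuple x0 + cis t *: (Cd_of_tuple x - Cd_of_tuple x0).
Proof.
apply/rowP => k; rewrite !mxE tnth_rot_lshift tnth_rot_rshift.
by apply/eqP; rewrite eq_complex /=; apply/andP; split; apply/eqP; ring.
Qed.

Lemma measurable_rot x0 : measurable_fun setT
  (fun p : R * tupd => rot x0 (cos p.1) (sin p.1) p.2).
Proof.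
have mc : measurable_fun setT (fun p : R * tupd => cos p.1).
  apply: (measurableT_comp (f := cos)) => //.
  by apply: continuous_measurable_fun; exact: continuous_cos.
have ms : measurable_fun setT (fun p : R * tupd => sin p.1).
  apply: (measurableT_comp (f := sin)) => //.
  by apply: continuous_measurable_fun; exact: continuous_sin.
have mt i : measurable_fun setT (fun p : R * tupd => tnth p.2 i - tnth x0 i).
  apply: measurable_funB => //.
  by apply: (measurableT_comp (measurable_tnth i)); exact: measurable_snd.
apply/measurable_fun_tnthP => i.
have -> : (tnth (T:=R))^~ i \o (fun p : R * tupd => rot x0 (cos p.1) (sin p.1) p.2) =
  (fun p : R * tupd => tnth (rot x0 (cos p.1) (sin p.1) p.2) i) by [].
rewrite -(splitK i); case: (fintype.split i) => k /=.
  under eq_fun do rewrite tnth_rot_lshift.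
  by apply: measurable_funD => //; apply: measurable_funB; apply: measurable_funM.
under eq_fun do rewrite tnth_rot_rshift.
by apply: measurable_funD => //; apply: measurable_funD; apply: measurable_funM.
Qed.

Local Open Scope ereal_scope.

(** Averaging over the angle of rotation turns a bound on circles around x0
    into a bound on the volume integral over any rotation invariant set. *)
Lemma integral_le_circle_means x0 (S : set tupd) (f : tupd -> \bar R) (k : R) :
  measurable S -> (forall t x, S (rot x0 (cos t) (sin t) x) <-> S x) ->
  measurable_fun setT f -> (forall x, S x -> 0 <= f x) ->
  (forall x, S x ->
    \int[mu]_(t in D) f (rot x0 (cos t) (sin t) x) <= (2 * pi * k)%:E) ->
  \int[lebT (d + d)]_(x in S) f x <= k%:E * lebT (d + d) S.
Proof.
move=> mS Srot mf f0 fk.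
pose r (p : R * tupd) := rot x0 (cos p.1) (sin p.1) p.2.
pose G := f \_ S.
have mG : measurable_fun setT G by apply/(measurable_restrictT f) => //; exact: measurable_funTS.
have G0 x : 0 <= G x.
  by rewrite /G patchE; case: ifPn => // /set_mem; exact: f0.
have IG : \int[lebT (d + d)]_(x in S) f x = \int[lebT (d + d)]_x G x.
  by rewrite integral_mkcond.
rewrite IG.
have mDT : measurable (D `*` setT : set (R * tupd)) by apply: measurableX.
pose F := (G \o r) \_ (D `*` setT).
have mF : measurable_fun setT F.
  apply/(measurable_restrictT (G \o r)) => //; apply: measurable_funTS.
  exact: measurableT_comp mG (measurable_rot x0).
have F0 p : 0 <= F p by rewrite /F patchE; case: ifP => // _; exact: G0.
have FE t x : F (t, x) = ((fun t => G (r (t, x))) \_ D) t.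
  rewrite /F !patchE; congr (if _ then _ else _).
  by apply/idP/idP; rewrite !inE; [case|split].
have swap := @fubini_tonelli _ _ _ _ R mu (lebT (d + d)) F mF F0.
have L : \int[mu]_t \int[lebT (d + d)]_x F (t, x) =
    \int[lebT (d + d)]_x G x * (2 * pi)%:E.
  transitivity (\int[mu]_(t in D) cst (\int[lebT (d + d)]_x G x) t).
    rewrite [RHS]integral_mkcond; apply: eq_integral => t _.
    rewrite patchE; case: ifPn => tD.
      have [_ rvp] := @volume_preserving_rot x0 (cos t) (sin t) (cos2Dsin2 t).
      rewrite /= -[RHS](rvp G)//; apply: eq_integral => x _.
      by rewrite FE patchE tD.
    by rewrite integral0_eq// => x _; rewrite FE patchE (negbTE tD).
  by rewrite integral_cst//; congr (_ * _); exact: mu_circle.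
have Rb : \int[lebT (d + d)]_x \int[mu]_t F (t, x) <= (2 * pi * k)%:E * lebT (d + d) S.
  apply: (@le_trans _ _ (\int[lebT (d + d)]_x (cst (2 * pi * k)%:E \_ S) x)).
    apply: ge0_le_integral => //.
    - by move=> x _; apply: integral_ge0.
    - exact: (@measurable_fun_fubini_tonelli_G _ _ _ _ R mu F mF F0).
    - by apply/(measurable_restrictT (cst (2 * pi * k)%:E)).
    move=> x _; under eq_integral do rewrite FE.
    rewrite -integral_mkcond patchE; case: ifPn => [/set_mem Sx|/negP nSx].
      apply: le_trans (fk x Sx); rewrite le_eqVlt; apply/orP; left; apply/eqP.
      by apply: eq_integral => t _; rewrite /G patchE ifT//; apply/mem_set/Srot.
    rewrite integral0_eq// => t _; rewrite /G patchE ifF//.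
    by apply/negP => /set_mem/Srot Sx; apply: nSx; exact: mem_set.
  by rewrite -integral_mkcond integral_cst.
have pi20 : (0 < 2 * pi :> R)%R by rewrite mulr_gt0 ?pi_gt0.
rewrite -(@lee_pmul2l _ (2 * pi)%:E)//.
rewrite muleC -L swap; apply: le_trans Rb _.
by rewrite EFinM muleA.
Qed.
End rotations.

(** * Measurability and uniform continuity on C^d *)

Section measurability_Cd.
Context {R : realType} {d : nat}.
Local Notation Cd := 'rV[R[i]]_d.
Local Notation tupd := ((d + d).-tuple R).
Local Notation toC := (@Cd_of_tuple R d).

Lemma cmod_le_ReIm (z : R[i]) : cmod z <= `|complex.Re z| + `|complex.Im z|.
Proof.
rewrite -[leLHS]ger0_norm ?cmod_ge0// -[leRHS]ger0_norm ?addr_ge0//.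
rewrite -ler_sqr ?nnegrE// !real_normK ?num_real// cmod_sqr sqrrD.
rewrite !real_normK ?num_real//.
by rewrite -addrA lerD2l lerDr mulrn_wge0// mulr_ge0.
Qed.

Lemma Cd_of_tuple_dist (x y : tupd) (e : R) :
  (forall i, `|tnth x i - tnth y i| <= e) ->
  forall k, cmod (toC x 0 k - toC y 0 k) <= e + e.
Proof.
move=> xy k; apply: le_trans (cmod_le_ReIm _) _.
by rewrite !mxE /= lerD.
Qed.

Lemma ReIm_le_cmod (z : R[i]) : `|complex.Re z| <= cmod z /\ `|complex.Im z| <= cmod z.
Proof.
have := cmod_sqr z; have := cmod_ge0 z; move: (cmod z) => c c0 cE.
split; rewrite -[leRHS]ger0_norm// -ler_sqr ?nnegrE// !real_normK ?num_real// cE.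
  by rewrite lerDl sqr_ge0.
by rewrite lerDr sqr_ge0.
Qed.

Let dist_aux (x y q e : R) :
  x - e <= q <= x + e -> q - e <= y <= q + e -> `|y - x| <= 2 * e.
Proof. by move=> /andP[? ?] /andP[? ?]; rewrite ler_norml; apply/andP; split; lra. Qed.

(** Rational cubes are a countable base, so that an open set pulls back to a
    countable union of measurable cubes. *)
Lemma measurable_open_Cd (U : set Cd) : open U -> measurable (toC @^-1` U).
Proof.
move=> oU.
pose J := ((d + d).-tuple rat * nat)%type.
pose Q (j : J) : set tupd := box (fun i => ratr (tnth j.1 i)) j.2.+1%:R^-1.
have -> : toC @^-1` U = \bigcup_(j in [set j | Q j `<=` toC @^-1` U]) Q j.
  apply/seteqP; split => [x /= Ux|x [j] /= jU /jU //].
  have /nbhs_CdP[e e0 eU] : nbhs (toC x) U by exact: open_nbhs_nbhs.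
  have [k ke] : exists k : nat, (4 / e < k.+1%:R :> R).
    exists (Num.Def.archi_bound (4 / e)); apply: (@lt_le_trans _ _ (Num.Def.archi_bound (4 / e))%:R).
      by apply: archi_boundP; rewrite divr_ge0// ltW.
    by rewrite ler_nat.
  have {}ke : 4 * k.+1%:R^-1 < e.
    by move: ke; rewrite !ltr_pdivrMr// mulrC.
  have k0 : 0 < k.+1%:R^-1 :> R by rewrite invr_gt0.
  have q_ex i : exists q : rat, tnth x i - k.+1%:R^-1 <= ratr q <= tnth x i + k.+1%:R^-1.
    have lt_x : tnth x i - k.+1%:R^-1 < tnth x i + k.+1%:R^-1.
      by move: (tnth x i) (k.+1%:R^-1) k0 => u v v0; lra.
    have [q] := rat_in_itvoo lt_x.
    by rewrite in_itv /= => /andP[q1 q2]; exists q; rewrite !ltW.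
  pose q : (d + d).-tuple rat := [tuple xchoose (q_ex i) | i < d + d].
  have qP i := xchooseP (q_ex i).
  exists (q, k); last first.
    move=> i /=; rewrite tnth_mktuple; have /andP[] := qP i.
    by rewrite lerBlDr => q1 q2; apply/andP; split; [rewrite lerBlDr|].
  move=> y yQ /=; apply: eU => j.
  apply: le_lt_trans ke; rewrite [leRHS](_ : _ = 2 * k.+1%:R^-1 + 2 * k.+1%:R^-1); last by ring.
  apply: Cd_of_tuple_dist => i; have := yQ i; rewrite /= tnth_mktuple.
  exact: dist_aux (qP i).
have -> : \bigcup_(j in [set j | Q j `<=` toC @^-1` U]) Q j =
    \bigcup_j (if `[< Q j `<=` toC @^-1` U >] then Q j else set0).
  apply/seteqP; split => x [j].
    by move=> /= jU jx; exists j => //; case: asboolP.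
  by case: asboolP => // jU _ jx; exists j.
apply: countable_bigcupT_measurable; first exact: countableP.
by move=> j; case: asboolP => _ //; exact: measurable_box.
Qed.

Lemma measurable_closed_Cd (A : set Cd) : closed A -> measurable (toC @^-1` A).
Proof.
move=> cA; rewrite -[A]setCK preimage_setC; apply: measurableC.
exact: measurable_open_Cd (closed_openC cA).
Qed.

Lemma compact_Cd_closed (A : set Cd) : compact A -> closed A.
Proof.
apply: compact_closed => x y xy; apply/rowP => k; apply/eqP.
rewrite -subr_eq0; apply: contraPT isT => xy0 _.
pose e := cmod (x 0 k - y 0 k) / 2.
have e0 : 0 < e by rewrite divr_gt0// cmod_gt0.
have [] := xy [set z : Cd | forall l, cmod (z 0 l - x 0 l) < e]
              [set z : Cd | forall l, cmod (z 0 l - y 0 l) < e].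
- by apply/nbhs_CdP; exists e.
- by apply/nbhs_CdP; exists e.
move=> z [/= /(_ k) zx /(_ k) zy].
have := cmodD (x 0 k - z 0 k) (z 0 k - y 0 k).
rewrite addrA subrK => /le_lt_trans /(_ (ltrD _ zy)).
rewrite cmodB => /(_ _ zx); rewrite -splitr ltxx; exact.
Qed.

Lemma measurable_lsc_Cd (f : Cd -> \bar R) : lower_semicontinuous f ->
  measurable_fun setT (f \o toC).
Proof.
move=> lf; apply: (measurability _ (ErealGenOInfty.measurableE R)).
move=> /= _ [_ [a ->]] <-; rewrite setTI comp_preimage preimage_itvoy.
apply: measurable_open_Cd.
by move/lower_semicontinuousP : lf; exact.
Qed.

Lemma continuous_lsc_Cd (f : Cd -> \bar R) : continuous f -> lower_semicontinuous f.
Proof.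
move=> cf z a az; exists [set y | (a%:E < f y)%E] => //.
apply: (cf z [set x : \bar R | (a%:E < x)%E]); apply: open_nbhs_nbhs; split => //.
exact: open_ereal_gt_ereal.
Qed.

Lemma measurable_continuous_Cd (f : Cd -> R) : continuous f ->
  measurable_fun setT (fun x => f (toC x)).
Proof.
move=> cf; apply/measurable_EFinP; apply: (measurable_lsc_Cd (f := EFin \o f)).
apply: continuous_lsc_Cd => z; apply: continuous_comp; first exact: cf.
by apply: cvg_EFin; [exact: nearW|exact: cvg_id].
Qed.

Definition square (M : R) : set R[i] := [set z | `|complex.Re z| <= M /\ `|complex.Im z| <= M].

Lemma compact_square M : compact (square M).
Proof.
have -> : square M = (fun p : R * R => p.1 +i* p.2) @` (`[- M, M] `*` `[- M, M]).
  apply/seteqP; split => [[a b] /= []|_ [[a b] /= [] + + <-]].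
    by rewrite !ler_norml => aM bM; exists (a, b) => //=; rewrite !in_itv.
  by rewrite !in_itv /= => aM bM; split; rewrite /= ler_norml.
apply: continuous_compact; last by apply: compact_setX; exact: segment_compact.
apply: continuous_subspaceT => -[a b].
apply/(@cvgrPdist_lt _ R[i]) => e e0.
have er := gt0_real_complex e0.
have e2 : 0 < complex.Re e / 2 by rewrite divr_gt0// -ltcR -er.
exists (ball a (complex.Re e / 2), ball b (complex.Re e / 2)).
  by split; exact: nbhsx_ballx.
move=> [x y] [/= ax by_].
rewrite er cmod_ltP; apply: le_lt_trans (cmod_le_ReIm _) _ => /=.
by rewrite [ltRHS]splitr; apply: ltrD.
Qed.

(** The near-covering form of compactness of the closed cube, with the radius
    as the running parameter. *)
Lemma uniform_continuity_Cd (f : Cd -> R) (M e : R) : continuous f -> 0 < e ->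
  exists2 r : R, 0 < r & forall z y : Cd,
    (forall k, square M (z 0 k)) -> (forall k, cmod (y 0 k - z 0 k) <= r) ->
    `|f y - f z| <= e.
Proof.
move=> cf e0.
have cA := @rV_compact R[i] d (fun _ => square M) (fun _ => @compact_square M).
have e2 : 0 < e / 2 by rewrite divr_gt0.
pose P (r : R) (z : Cd) := forall y : Cd, (forall k, cmod (y 0 k - z 0 k) <= r) ->
  `|f y - f z| <= e.
have : \forall r \near 0^'+, [set v : Cd | forall i, square M (v ord0 i)] `<=` P r.
  move/compact_near_coveringP : cA => /(_ _ (0^'+ : set_system R) P _); apply => z _.
  have /nbhs_CdP[s s0 sf] : nbhs z [set y | `|f z - f y| < e / 2].
    by apply: (cf z [set x | `|f z - x| < e / 2]); apply/nbhs_ballP; exists (e / 2).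
  exists ([set y : Cd | forall k, cmod (y 0 k - z 0 k) < s / 2], [set r | r < s / 2]).
    split; first by apply/nbhs_CdP; exists (s / 2) => //; rewrite divr_gt0.
    by apply: nbhs_right_lt; rewrite divr_gt0.
  move=> [z' r] /= [z'z rs] y yz'.
  have s2 : s / 2 < s by rewrite ltr_pdivrMr// ltr_pMr// ltr1n.
  have h1 := sf z' (fun k => lt_trans (z'z k) s2).
  have h2 : `|f z - f y| < e / 2.
    apply: sf => k; have -> : y 0 k - z 0 k = (y 0 k - z' 0 k) + (z' 0 k - z 0 k).
      by rewrite addrA subrK.
    apply: le_lt_trans (cmodD _ _) _; rewrite [ltRHS]splitr.
    by apply: ler_ltD => //; apply: le_trans (yz' k) (ltW rs).
  have -> : f y - f z' = (f z - f z') - (f z - f y) by ring.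
  apply: le_trans (ler_normB _ _) _; rewrite [leRHS]splitr lerD// ltW//.
move=> H; near (0 : R)^'+ => r; exists r => //.
by move=> z y zM; apply: (near H r _).
Unshelve. all: by end_near. Qed.

End measurability_Cd.

(** * Complex random variables and small ball probabilities *)

Section complex_measurability.
Context {R : realType}.

Lemma measurable_continuous_complex (f : R[i] -> R) : continuous f ->
  measurable_fun setT f.
Proof.
move=> cf; apply: (measurability _ (RGenOpens.measurableE R)).
move=> _ [_ [a [b ->] <-]]; rewrite setTI; apply: sub_sigma_algebra.
by move/continuousP : cf; apply; exact: interval_open.
Qed.

Lemma continuous_Re : continuous (fun z : R[i] => complex.Re z).
Proof.
move=> z; apply/(@cvgrPdist_lt _ _ _ (nbhs z) _) => e e0.
apply/nbhs_ballP; exists e%:C => /=; first by rewrite ltcR.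
move=> y; rewrite ballCP cmodB => zy; apply: le_lt_trans zy.
by have [] := ReIm_le_cmod (z - y); case: (z) (y) => [? ?] [? ?].
Qed.

Lemma continuous_Im : continuous (fun z : R[i] => complex.Im z).
Proof.
move=> z; apply/(@cvgrPdist_lt _ _ _ (nbhs z) _) => e e0.
apply/nbhs_ballP; exists e%:C => /=; first by rewrite ltcR.
move=> y; rewrite ballCP cmodB => zy; apply: le_lt_trans zy.
by have [_] := ReIm_le_cmod (z - y); case: (z) (y) => [? ?] [? ?].
Qed.

(** Measurability through real and imaginary parts, which is stable under the
    ring operations by the corresponding real statements. *)
Definition cmeasurable d (T : measurableType d) (f : T -> R[i]) : Prop :=
  measurable_fun setT (fun x => complex.Re (f x)) /\
  measurable_fun setT (fun x => complex.Im (f x)).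

Context d (T : measurableType d).
Implicit Types f g : T -> R[i].

Lemma cmeasurable_comp f : measurable_fun setT f -> cmeasurable f.
Proof.
move=> mf; split; apply: measurableT_comp mf;
  apply: measurable_continuous_complex; [exact: continuous_Re|exact: continuous_Im].
Qed.

Lemma cmeasurable_cst (c : R[i]) : cmeasurable (fun _ : T => c).
Proof. by split; exact: measurable_cst. Qed.

Lemma cmeasurableD f g : cmeasurable f -> cmeasurable g ->
  cmeasurable (fun x => f x + g x).
Proof.
move=> [fr fi] [gr gi]; split.
  under eq_fun do rewrite raddfD; exact: measurable_funD.
under eq_fun do rewrite raddfD; exact: measurable_funD.
Qed.

Lemma cmeasurableM f g : cmeasurable f -> cmeasurable g ->
  cmeasurable (fun x => f x * g x).
Proof.
move=> [fr fi] [gr gi]; split.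
  rewrite (_ : (fun x => _) = fun x => complex.Re (f x) * complex.Re (g x) -
      complex.Im (f x) * complex.Im (g x)).
    by apply: measurable_funB; exact: measurable_funM.
  by apply/funext => x; case: (f x) (g x) => [? ?] [? ?].
rewrite (_ : (fun x => _) = fun x => complex.Re (f x) * complex.Im (g x) +
    complex.Im (f x) * complex.Re (g x)).
  by apply: measurable_funD; exact: measurable_funM.
by apply/funext => x; case: (f x) (g x) => [? ?] [? ?].
Qed.

Lemma cmeasurable_sum (I : Type) (s : seq I) (F : I -> T -> R[i]) :
  (forall i, cmeasurable (F i)) -> cmeasurable (fun x => \sum_(i <- s) F i x).
Proof.
move=> mF; elim: s => [|i s IH].
  under [X in cmeasurable X]eq_fun do rewrite big_nil; exact: cmeasurable_cst.
by under [X in cmeasurable X]eq_fun do rewrite big_cons; exact: cmeasurableD.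
Qed.

Lemma cmeasurable_prod (I : Type) (s : seq I) (F : I -> T -> R[i]) :
  (forall i, cmeasurable (F i)) -> cmeasurable (fun x => \prod_(i <- s) F i x).
Proof.
move=> mF; elim: s => [|i s IH].
  under [X in cmeasurable X]eq_fun do rewrite big_nil; exact: cmeasurable_cst.
by under [X in cmeasurable X]eq_fun do rewrite big_cons; exact: cmeasurableM.
Qed.

Lemma cmeasurableX f n : cmeasurable f -> cmeasurable (fun x => f x ^+ n).
Proof.
move=> mf; elim: n => [|n IH].
  under [X in cmeasurable X]eq_fun do rewrite expr0; exact: cmeasurable_cst.
by under [X in cmeasurable X]eq_fun do rewrite exprS; exact: cmeasurableM.
Qed.

Lemma measurable_cmod f : cmeasurable f -> measurable_fun setT (fun x => cmod (f x)).
Proof.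
move=> [fr fi].
rewrite (_ : (fun x => _) = fun x =>
    Num.sqrt (complex.Re (f x) ^+ 2 + complex.Im (f x) ^+ 2)); last first.
  by apply/funext => x; case: (f x).
have msqrt : measurable_fun setT (fun x : R => Num.sqrt x).
  by apply: continuous_measurable_fun; exact: sqrt_continuous.
apply: (measurableT_comp msqrt).
by apply: measurable_funD; exact: measurable_funX.
Qed.

End complex_measurability.

Section small_ball.
Context {d0 : measure_display} {T : measurableType d0} {R : realType}.
Variable P : probability T R.

(** Conditioning on a variable with countably many values. *)
Lemma probability_le_countable_condition (E : set T) (G : T -> nat) (q : R) :
  measurable E -> (forall n, measurable (G @^-1` [set n])) -> 0 <= q ->
  (forall n, P (E `&` G @^-1` [set n]) <= q%:E * P (G @^-1` [set n]))%E ->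
  (P E <= q%:E)%E.
Proof.
move=> mE mG q0 PEG.
have tG : trivIset setT (fun n => G @^-1` [set n]).
  by move=> i j _ _ [w [/= <- <-]].
have cG : \bigcup_n (G @^-1` [set n]) = setT by apply/seteqP; split=> // w _; exists (G w).
have -> : E = \bigcup_n (E `&` G @^-1` [set n]) by rewrite -setI_bigcupr cG setIT.
rewrite measure_bigcup//; first last.
- exact: trivIset_setIl.
- by move=> i _; exact: measurableI.
have -> : q%:E = (q%:E * \sum_(i <oo | i \in setT) P (G @^-1` [set i]))%E.
  by have P1 := probability_setT P; rewrite -[LHS]mule1 -P1 -cG measure_bigcup.
by rewrite -nneseriesZl//; apply: lee_nneseries => n _ //; exact: PEG.
Qed.

(** The half-open square of side h that contains z. *)
Definition grid (h : R) (z : R[i]) : int * int :=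
  (Num.floor (complex.Re z / h), Num.floor (complex.Im z / h)).

Lemma grid_dist (h : R) z y : 0 < h -> grid h z = grid h y -> cmod (z - y) <= 2 * h.
Proof.
move=> h0 [zyR zyI]; apply: le_trans (cmod_le_ReIm _) _; rewrite mulr2n mulrDl mul1r.
have aux (u v : R) : Num.floor (u / h) = Num.floor (v / h) -> `|u - v| <= h.
  move=> uv; have /andP[u1 u2] := floor_itv (u / h); have /andP[v1 v2] := floor_itv (v / h).
  rewrite {}uv in u1 u2.
  have : `|u / h - v / h| <= 1.
    by rewrite ler_norml; move: u2 v2; rewrite !intrD => u2 v2; apply/andP; split; lra.
  by rewrite -mulrBl normrM normfV (gtr0_norm h0) ler_pdivrMr// mul1r.
by apply: lerD; rewrite raddfB; apply: aux.
Qed.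

Lemma measurable_grid (h : R) (k : int * int) : 0 < h ->
  measurable [set z : R[i] | grid h z = k].
Proof.
move=> h0; case: k => k l.
have mf (g : R[i] -> R) (j : int) : continuous g -> measurable [set z | Num.floor (g z / h) = j].
  move=> /measurable_continuous_complex mg.
  rewrite [X in measurable X](_ : _ = g @^-1` `[j%:~R * h, (j + 1)%:~R * h[%classic).
    rewrite -[X in measurable X]setTI; apply: mg => //; exact: measurable_itv.
  apply/seteqP; split => z /=; rewrite in_itv /= -ler_pdivlMr// -ltr_pdivrMr//.
    by move=> <-; exact: floor_itv.
  by move=> ?; exact: floor_def.
have -> : [set z | grid h z = (k, l)] = [set z | Num.floor (complex.Re z / h) = k] `&`
    [set z | Num.floor (complex.Im z / h) = l].
  by rewrite /grid; apply/seteqP; split => z /= [-> ->].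
by apply: measurableI; apply: mf; [exact: continuous_Re|exact: continuous_Im].
Qed.

(** A sum of independent variables is at most as concentrated as any one of
    its terms: condition on the small squares that contain the other terms.
    Given these, the event forces the remaining term into a fixed disc, and
    independence makes the probabilities factor. *)
Lemma small_ball_sum (I : choiceType) (A : set I) (X : I -> {RV P >-> R[i]})
    (i0 : I) (s : seq I) (c : I -> R[i]) (r q : R) :
  mutually_independent A X -> uniq (i0 :: s) -> (forall i, i \in i0 :: s -> A i) ->
  c i0 != 0 -> 0 < r ->
  (concentration P (X i0) (2 * r / cmod (c i0)) <= q%:E)%E ->
  (P [set w | (cmod (\sum_(i <- i0 :: s) X i w * c i) < r)%R] <= q%:E)%E.
Proof.
move=> ind us sA c0 r0 cq.
have cm0 : 0 < cmod (c i0) by rewrite cmod_gt0.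
have q0 : 0 <= q.
  rewrite -lee_fin; apply: le_trans cq.
  apply: (@le_trans _ _ (P [set w | cmod (X i0 w - 0) < 2 * r / cmod (c i0)])).
    exact: measure_ge0.
  by apply: ereal_sup_ubound; exists 0.
pose S := 1 + \sum_(i <- s) cmod (c i).
have S0 : 0 < S by rewrite ltr_pwDl// sumr_ge0// => i _; exact: cmod_ge0.
pose h := r / (2 * S).
have h0 : 0 < h by rewrite divr_gt0// mulr_gt0.
pose G w := pickle [seq grid h (X i w) | i <- s].
have mX i : measurable_fun setT (X i) by [].
(* A nonempty fiber is described by the squares met at one of its points
   w0, and the values of the other terms at w0 serve as the constants. *)
have fiber n : (G @^-1` [set n] = set0) \/ exists w0, G @^-1` [set n] =
    \bigcap_(i in [set` s]) X i @^-1` [set z | grid h z = grid h (X i w0)].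
  have [[w0 Gw0]|no] := pselect (exists w0, G w0 = n); [right|left]; last first.
    by apply/seteqP; split => // w Gw; apply: no; exists w.
  exists w0; apply/seteqP; split => w /=.
    rewrite -Gw0 => /(pcan_inj pickleK) /eq_in_map gE i /= si; exact: gE.
  by move=> gE; rewrite -Gw0; congr pickle; apply/eq_in_map => i si; exact: gE.
have mcell w0 i : measurable [set z : R[i] | grid h z = grid h (X i w0)].
  exact: measurable_grid.
have mXcell w0 i : measurable (X i @^-1` [set z | grid h z = grid h (X i w0)]).
  by rewrite -[X in measurable X]setTI; apply: mX.
have mbig w0 : measurable (\bigcap_(i in [set` s]) X i @^-1` [set z | grid h z = grid h (X i w0)]).
  by rewrite bigcap_seq; apply: bigsetI_measurable => i _; exact: mXcell.
have mE : measurable [set w | cmod (\sum_(i <- i0 :: s) X i w * c i) < r].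
  have mc : measurable_fun setT (fun w => cmod (\sum_(i <- i0 :: s) X i w * c i)).
    apply: measurable_cmod; apply: cmeasurable_sum => i; apply: cmeasurableM.
      exact: cmeasurable_comp.
    exact: cmeasurable_cst.
  rewrite -[X in measurable X]setTI.
  by have := mc measurableT _ (measurable_itv `]-oo, r[); rewrite set_itvE.
apply: (@probability_le_countable_condition _ G) => // n.
  by have [->|[w0 ->]] := fiber n.
have [->|[w0 fn]] := fiber n; first by rewrite setI0 measure0 mule0.
(* On this fiber the other terms sum to y up to an error r, whence the
   radius 2 r for the remaining term. *)
pose y := \sum_(i <- s) X i w0 * c i.
pose B0 : set R[i] := [set z | cmod (z - - (y / c i0)) < 2 * r / cmod (c i0)].
have mB0 : measurable B0.
  have mc : measurable_fun setT (fun z : R[i] => cmod (z - - (y / c i0))).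
    apply: measurable_cmod; apply: cmeasurableD; last exact: cmeasurable_cst.
    by apply: cmeasurable_comp; exact: measurable_id.
  rewrite -[X in measurable X]setTI.
  by have := mc measurableT _ (measurable_itv `]-oo, (2 * r / cmod (c i0))[);
    rewrite set_itvE.
pose B i := if i == i0 then B0 else [set z | grid h z = grid h (X i w0)].
have mB i : measurable (B i) by rewrite /B; case: eqP => _ //; exact: mcell.
have i0s : i0 \notin s by move: us => /= /andP[].
have Bs i : i \in s -> B i = [set z | grid h z = grid h (X i w0)].
  by rewrite /B; case: eqP => // ->; rewrite (negbTE i0s).
have fB : G @^-1` [set n] = \bigcap_(i in [set` s]) X i @^-1` B i.
  by rewrite fn; apply: eq_bigcapr => i /= si; rewrite Bs.
have sub : [set w | cmod (\sum_(i <- i0 :: s) X i w * c i) < r] `&` G @^-1` [set n] `<=`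
    \bigcap_(i in [set` i0 :: s]) X i @^-1` B i.
  move=> w [/= wr wn] i; rewrite /= inE => /predU1P[->|si]; last first.
    by move: wn; rewrite -[G w = n]/((G @^-1` [set n]) w) fB; apply.
  rewrite /= /B eqxx /B0 /= opprK.
  have -> : X i0 w + y / c i0 = (X i0 w * c i0 + y) / c i0 by rewrite mulrDl mulfK.
  rewrite cmodM ComplexField.Normc.normcV ltr_pM2r ?invr_gt0//.
  have -> : X i0 w * c i0 + y = \sum_(i <- i0 :: s) X i w * c i +
      \sum_(i <- s) (X i w0 - X i w) * c i.
    rewrite big_cons -addrA -big_split /=; congr (_ + _).
    by apply: eq_bigr => j _; rewrite -mulrDl addrC subrK.
  apply: le_lt_trans (cmodD _ _) _; rewrite mulr2n mulrDl mul1r; apply: ltr_leD => //.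
  apply: le_trans (cmod_sum_le _ _ _) _.
  apply: (@le_trans _ _ (\sum_(j <- s) 2 * h * cmod (c j))).
    rewrite big_seq [leRHS]big_seq; apply: ler_sum => j js.
    rewrite cmodM ler_wpM2r ?cmod_ge0//; apply: grid_dist => //.
    move: wn; rewrite -[G w = n]/((G @^-1` [set n]) w) fn => /(_ j js) /= ->.
    by [].
  rewrite -mulr_sumr; apply: (@le_trans _ _ (2 * h * S)).
    by apply: ler_wpM2l; [rewrite mulr_ge0// ltW|rewrite /S lerDr].
  by rewrite /h le_eqVlt; apply/orP; left; apply/eqP; field; rewrite gt_eqF.
have mXB i : measurable (X i @^-1` B i).
  by rewrite -[X in measurable X]setTI; exact: mX.
have mcap (u : seq I) : measurable (\bigcap_(i in [set` u]) X i @^-1` B i).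
  by rewrite bigcap_seq; apply: bigsetI_measurable => i _; exact: mXB.
have mGn : measurable (G @^-1` [set n]) by rewrite fB; exact: mcap.
apply: (le_trans (le_measure _ _ _ sub)); rewrite ?inE//; first exact: measurableI.
have us' : uniq s by move: us => /= /andP[].
have sA' i : i \in s -> A i by move=> si; apply: sA; rewrite inE si orbT.
have e1 := ind (i0 :: s) B us sA (fun i _ => mB i).
have e2 := ind s B us' sA' (fun i _ => mB i).
rewrite fB; apply: (@le_trans _ _ (\prod_(i <- i0 :: s) P (X i @^-1` B i))%E).
  by rewrite -e1.
rewrite [X in (_ <= _ * X)%E]e2.
rewrite big_cons lee_wpmul2r//; first by apply: prode_ge0.
apply: le_trans cq; apply: ereal_sup_ubound; exists (- (y / c i0)) => //.
by rewrite /B eqxx.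
Qed.
End small_ball.

(** * The sub-mean value inequality over polydiscs *)

Section polydiscs.
Context {R : realType} {d : nat}.
Local Notation Cd := 'rV[R[i]]_d.
Local Notation tupd := ((d + d).-tuple R).
Local Notation toC := (@Cd_of_tuple R d).
Local Notation mu := (@lebesgue_measure R).

Definition tuple_of_Cd (z : Cd) : tupd := [tuple match fintype.split i with
  | inl k => complex.Re (z 0 k) | inr k => complex.Im (z 0 k) end | i < d + d].

Lemma tuple_of_CdK : cancel tuple_of_Cd toC.
Proof.
move=> z; apply/rowP => k; rewrite !mxE !tnth_mktuple (unsplitK (inl k)) (unsplitK (inr k)).
by case: (z 0 k).
Qed.

Definition polydisc (z : Cd) (r : R) : set Cd :=
  [set y | forall k, cmod (y 0 k - z 0 k) <= r].

Lemma cmeasurable_toC k : cmeasurable (fun x : tupd => toC x 0 k).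
Proof.
split; under eq_fun do rewrite mxE /=; exact: measurable_tnth.
Qed.

Lemma measurable_polydisc z r : measurable (toC @^-1` polydisc z r).
Proof.
have -> : toC @^-1` polydisc z r = \bigcap_(k in [set: 'I_d])
    ((fun x => cmod (toC x 0 k - z 0 k)) @^-1` `]-oo, r]).
  by apply/seteqP; split => x /= H k; have := H k; rewrite /= in_itv /=; [|exact].
apply: fin_bigcap_measurable => // k _.
have mf : measurable_fun setT (fun x => cmod (toC x 0 k - z 0 k)).
  apply: measurable_cmod; apply: cmeasurableD; first exact: cmeasurable_toC.
  exact: cmeasurable_cst.
by rewrite -[X in measurable X]setTI; apply: mf => //; exact: measurable_itv.
Qed.

Lemma lebT_polydisc_le z r : 0 <= r ->
  (lebT (d + d) (toC @^-1` polydisc z r) <= ((2 * r) ^+ (d + d))%:E)%E.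
Proof.
move=> r0; rewrite -(lebesgue_tuple_box (fun i => tnth (tuple_of_Cd z) i) r0).
apply: le_measure; rewrite ?inE; [exact: measurable_polydisc|exact: measurable_box|].
move=> x xz i; rewrite tnth_mktuple -ler_distlC distrC.
rewrite -(splitK i); case: (fintype.split i) => k; rewrite unsplitK /=;
  apply: le_trans (xz k); have [h1 h2] := ReIm_le_cmod (toC x 0 k - z 0 k).
  by apply: le_trans h1; rewrite raddfB /= mxE.
by apply: le_trans h2; rewrite raddfB /= mxE.
Qed.

Lemma lebT_polydisc_lty z r : 0 <= r ->
  (lebT (d + d) (toC @^-1` polydisc z r) < +oo)%E.
Proof. by move=> r0; apply: le_lt_trans (lebT_polydisc_le z r0) _; rewrite ltry. Qed.

Lemma polydisc_rot x0 r t x :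
  polydisc (toC x0) r (toC (rot x0 (cos t) (sin t) x)) <-> polydisc (toC x0) r (toC x).
Proof.
rewrite Cd_of_tuple_rot /polydisc /=.
have E k : cmod ((toC x0 + cis t *: (toC x - toC x0)) 0 k - toC x0 0 k) =
    cmod (toC x 0 k - toC x0 0 k).
  by rewrite 2!mxE addrAC subrr add0r mxE cmodM cmod_cis mul1r !mxE.
by split=> H k; have := H k; rewrite E.
Qed.

Lemma cmeasurable_peval dT (T : measurableType dT) (g : T -> tupd)
    (q : mpoly.mpoly d R[i]) : measurable_fun setT g ->
  cmeasurable (fun x => peval q (toC (g x))).
Proof.
move=> mg; rewrite /peval.
under [X in cmeasurable X]eq_fun do rewrite mpoly.mevalE.
apply: cmeasurable_sum => m; apply: cmeasurableM; first exact: cmeasurable_cst.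
apply: cmeasurable_prod => k; apply: cmeasurableX.
have [mr mi] := cmeasurable_toC k.
by split; [exact: (measurableT_comp mr mg)|exact: (measurableT_comp mi mg)].
Qed.

Lemma measurable_log_peval n (q : mpoly.mpoly d R[i]) :
  measurable_fun setT (fun x : tupd => log_peval n q (toC x)).
Proof.
apply: measurable_funeM; apply: measurable_lne_EFin; apply: measurable_cmod.
exact: cmeasurable_peval.
Qed.

Local Open Scope ereal_scope.

(** Subtracting the potential from a constant M leaves a function that is
    nonnegative wherever M is an upper bound. *)
Lemma circle_mean_log_peval n (q : mpoly.mpoly d R[i]) (z v : Cd) (M A : R) :
  (0 < n)%N -> A%:E <= log_peval n q z ->
  \int[mu]_(t in `[0%R, (2 * pi)%R]) (M%:E - log_peval n q (z + cis t *: v)%R) <=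
    (2 * pi * (M - A))%:E.
Proof.
move=> n0 Aq; have n0' : (0 < n%:R^-1 :> R)%R by rewrite invr_gt0 ltr0n.
have [Q _ QE] := @peval_line R d q (mpoly.msize q) z v (leqnSn _).
have q0 : peval q z != 0%R.
  apply: contraTneq Aq => q0.
  rewrite /log_peval q0 ComplexField.Normc.normc0 le0_lneNy// gt0_muleNy ?lte_fin//.
have Q0 : Q.[0]%R != 0%R by rewrite QE scale0r addr0.
have [iQ leQ] := jensen_horner Q0.
have mD : measurable (`[0, 2 * pi]%classic%R : set (measurableTypeR R)) by exact: measurable_itv.
have iM : mu.-integrable (`[0%R, (2 * pi)%R]%classic : set R) (EFin \o cst M).
  by apply: continuous_integrable_itv => ?; exact: cvg_cst.
have iL := integrableZl mD n%:R^-1 iQ.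
rewrite /log_peval; under eq_integral do rewrite -QE.
rewrite integralB// integralZl// integral_cst_circle mulrBr EFinB.
apply: leeB => //.
have Aq' : (A <= n%:R^-1 * ln (cmod Q.[0]))%R.
  by move: Aq; rewrite /log_peval -[z]addr0 -(scale0r v) -QE lne_EFin ?cmod_gt0.
apply: (@le_trans _ _ ((n%:R^-1)%:E * (2 * pi * ln (cmod Q.[0]))%:E)).
  by rewrite -EFinM lee_fin mulrCA ler_wpM2l// mulr_ge0// pi_ge0.
by rewrite lee_wpmul2l// lee_fin ltW.
Qed.

(** The volume form of the sub-mean value inequality. *)
Lemma area_submean n (q : mpoly.mpoly d R[i]) (z : Cd) (r M A : R) :
  (0 < n)%N -> (0 <= r)%R -> A%:E <= log_peval n q z ->
  (forall y, polydisc z r y -> log_peval n q y <= M%:E) ->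
  \int[lebT (d + d)]_(x in toC @^-1` polydisc z r) (M%:E - log_peval n q (toC x)) <=
    (M - A)%:E * lebT (d + d) (toC @^-1` polydisc z r).
Proof.
move=> n0 r0 Aq qM; rewrite -[z]tuple_of_CdK.
apply: integral_le_circle_means.
- exact: measurable_polydisc.
- by move=> t x; exact: polydisc_rot.
- by apply: emeasurable_funB => //; exact: measurable_log_peval.
- by move=> x; rewrite /= tuple_of_CdK => /qM; rewrite sube_ge0 ?orbT.
- move=> x _; under eq_integral do rewrite Cd_of_tuple_rot.
  by apply: circle_mean_log_peval => //; rewrite tuple_of_CdK.
Qed.

(** A single point where q does not vanish is enough: the volume inequality
    bounds the integral of M minus the potential. *)
Lemma log_peval_integrable_polydisc n (q : mpoly.mpoly d R[i]) (z : Cd) (r M : R) :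
  (0 < n)%N -> (0 <= r)%R -> peval q z != 0%R ->
  (forall y, polydisc z r y -> log_peval n q y <= M%:E) ->
  (lebT (d + d)).-integrable (toC @^-1` polydisc z r) (log_peval n q \o toC).
Proof.
move=> n0 r0 qz qM; set S := toC @^-1` _.
have mS : measurable S by exact: measurable_polydisc.
have cm0 : (0 < cmod (peval q z))%R by rewrite cmod_gt0.
have Aq : (n%:R^-1 * ln (cmod (peval q z)))%:E <= log_peval n q z.
  by rewrite /log_peval lne_EFin.
have iG : (lebT (d + d)).-integrable S (fun x => M%:E - log_peval n q (toC x)).
  apply/integrableP; split.
    by apply: measurable_funTS; apply: emeasurable_funB => //; exact: measurable_log_peval.
  under eq_integral => x /set_mem Sx.
    rewrite gee0_abs; last by rewrite sube_ge0 ?orbT//; exact: qM.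
    over.
  apply: le_lt_trans (area_submean n0 r0 Aq qM) _.
  rewrite lte_mul_pinfty ?lebT_polydisc_lty// lee_fin subr_ge0 -lee_fin (le_trans Aq)// qM//.
  by move=> k; rewrite subrr ComplexField.Normc.normc0.
have iM : (lebT (d + d)).-integrable S (EFin \o cst M).
  apply: measurable_bounded_integrable => //; first exact: lebT_polydisc_lty.
  exact: bounded_cst.
have := integrableB mS iM iG; apply: eq_integrable => // x /set_mem Sx /=.
have := log_peval_lty n q (toC x); case: (log_peval n q (toC x)) => // a _.
by rewrite -!EFinB; congr EFin; ring.
Qed.

End polydiscs.

(** * Local integrability *)

Section compact_sets.
Context {R : realType} {d : nat}.
Local Notation Cd := 'rV[R[i]]_d.
Local Notation tupd := ((d + d).-tuple R).
Local Notation toC := (@Cd_of_tuple R d).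

Lemma compact_continuous_bounded (L : set Cd) (g : Cd -> R) :
  compact L -> continuous g -> exists2 M : R, 0 < M & forall z, L z -> g z <= M.
Proof.
move=> cL cg.
have : \forall M \near +oo, L `<=` [set z | g z <= M].
  move/compact_near_coveringP : cL => /(_ _ (+oo : set_system R) (fun M z => g z <= M) _).
  apply => z _.
  exists ([set y | g y < g z + 1], [set M | g z + 1 < M]); last first.
    by move=> [y M] /= [yz zM]; apply/ltW; exact: lt_trans yz zM.
  split; last by apply: nbhs_pinfty_gt; exact: num_real.
  apply: (cg z [set r | r < g z + 1]); apply: open_nbhs_nbhs; split; first exact: open_lt.
  by rewrite /= ltrDl.
move=> H; near (+oo : set_system R) => M; exists M => //.
exact: (near H M).
Unshelve. all: by end_near. Qed.

Lemma compact_Cd_bounded (L : set Cd) : compact L ->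
  exists2 M : R, 0 < M & L `<=` polydisc 0 M.
Proof.
move=> cL.
have cg : continuous (fun z : Cd => \sum_(k < d) cmod (z 0 k)).
  have ca : continuous (fun x : R * R => x.1 + x.2).
    by move=> x; apply: cvgD; [exact: cvg_fst|exact: cvg_snd].
  apply: (@continuous_big R _ _ _ _ ca) => k _ z.
  apply: (@continuous_comp _ _ _ (fun z : Cd => z 0 k)); last exact: continuous_cmod.
  exact: (@coord_continuous R[i]).
have [M M0 LM] := compact_continuous_bounded cL cg.
exists M => // z Lz k; rewrite mxE subr0; apply: le_trans (LM z Lz).
by rewrite (bigD1 k)//= lerDl sumr_ge0// => j _; exact: cmod_ge0.
Qed.

Lemma compact_polydisc (z : Cd) (r : R) : compact (polydisc z r).
Proof.
have [M M0 MP] : exists2 M : R, 0 < M & polydisc z r `<=` [set v | forall i, square M (v ord0 i)].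
  exists (1 + `|r| + \sum_(k < d) cmod (z 0 k)).
    by rewrite ltr_pwDl ?sumr_ge0// ?ltr_pwDl// => k _; exact: cmod_ge0.
  move=> y yz k.
  have yM : cmod (y ord0 k) <= 1 + `|r| + \sum_(k < d) cmod (z 0 k).
    rewrite -[y ord0 k](subrK (z 0 k)); apply: le_trans (cmodD _ _) _; apply: lerD.
      by apply: le_trans (yz k) _; rewrite (le_trans (ler_norm _))// lerDr.
    by rewrite (bigD1 k)//= lerDl sumr_ge0// => j _; exact: cmod_ge0.
  by have [h1 h2] := ReIm_le_cmod (y ord0 k); split; exact: le_trans yM.
apply: subclosed_compact MP; last first.
  exact: (@rV_compact R[i] d (fun _ => square M) (fun _ => @compact_square R M)).
have -> : polydisc z r = \bigcap_(k in [set: 'I_d])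
    ((fun y : Cd => cmod (y 0 k - z 0 k)) @^-1` [set x | x <= r]).
  by apply/seteqP; split => y H k; [move=> _|]; exact: H.
apply: closed_bigI => k _; apply: closed_comp; last exact: closed_le.
move=> y _; apply: (@continuous_comp _ _ _ (fun y : Cd => y 0 k - z 0 k)); last exact: continuous_cmod.
by apply: (@cvgB R[i] R[i] _ (nbhs y) _); [exact: (@coord_continuous R[i] 1 d 0 k y)|exact: cvg_cst].
Qed.

Lemma log_peval_bounded n (q : mpoly.mpoly d R[i]) (L : set Cd) :
  (0 < n)%N -> compact L -> exists M : R, forall z, L z -> (log_peval n q z <= M%:E)%E.
Proof.
move=> n0 cL; have [M M0 LM] := compact_continuous_bounded cL (@continuous_cmod_peval R d q).
have n0' : 0 < n%:R :> R by rewrite ltr0n.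
exists (ln M / n%:R) => z Lz; rewrite log_peval_leP// mulrCA divff ?gt_eqF// mulr1.
by rewrite lnK ?posrE//; exact: LM.
Qed.

(** Every compact set lies in a polydisc around a point where q does not
    vanish. *)
Lemma log_peval_L1loc n (q : mpoly.mpoly d R[i]) (z0 : Cd) :
  (0 < n)%N -> peval q z0 != 0 -> L1loc (log_peval n q).
Proof.
move=> n0 qz0 L cL.
have [M M0 LM] := compact_Cd_bounded cL.
pose r := M + \sum_(k < d) cmod (z0 0 k).
have r0 : 0 <= r by rewrite addr_ge0 ?(ltW M0)// sumr_ge0// => k _; exact: cmod_ge0.
have Lr : L `<=` polydisc z0 r.
  move=> z Lz k; apply: le_trans (cmodD _ _) _; rewrite cmodN; apply: lerD.
    by have := LM z Lz k; rewrite mxE subr0.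
  by rewrite (bigD1 k)//= lerDl sumr_ge0// => j _; exact: cmod_ge0.
have [C qC] := log_peval_bounded q n0 (@compact_polydisc z0 r).
have := log_peval_integrable_polydisc n0 r0 qz0 qC.
apply: integrableS; [exact: measurable_polydisc| |by move=> x; exact: Lr].
by apply: measurable_closed_Cd; exact: compact_Cd_closed.
Qed.

Lemma continuous_L1loc (f : Cd -> R) : continuous f -> L1loc (EFin \o f).
Proof.
move=> cf L cL.
have [M M0 LM] := compact_Cd_bounded cL.
have mL : measurable (toC @^-1` L) by apply: measurable_closed_Cd; exact: compact_Cd_closed.
have cn : continuous (fun z => `|f z|).
  by move=> z; apply: continuous_comp; [exact: cf|exact: norm_continuous].
have [C C0 fC] := compact_continuous_bounded cL cn.
have mf : measurable_fun setT (fun x => f (toC x)).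
  exact: measurable_continuous_Cd.
apply: (@measurable_bounded_integrable _ _ _ (lebT (d + d)) (fun x => f (toC x))) => //.
- apply: le_lt_trans (_ : lebT (d + d) (toC @^-1` polydisc 0 M) < +oo)%E.
    by apply: le_measure; rewrite ?inE//; [exact: measurable_polydisc|move=> x; exact: LM].
  by apply: lebT_polydisc_lty; exact: ltW.
- exact: measurable_funTS.
- exists C; split; first exact: num_real.
  by move=> y Cy x Lx; apply: le_trans (fC _ Lx) (ltW Cy).
Qed.

End compact_sets.

(** * Closeness in L^1 from finitely many points *)

Section grids.
Context {R : realType}.

(** The last cell is closed on the right, which takes care of t = M. *)
Lemma grid_interval (M t : R) (N : nat) : 0 < M -> (0 < N)%N -> `|t| <= M ->
  exists k : 'I_N, `|t - (- M + 2 * M / N%:R * k%:R)| <= 2 * M / N%:R.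
Proof.
move=> M0 N0 tM; set h := 2 * M / N%:R.
have N0' : 0 < N%:R :> R by rewrite ltr0n.
have h0 : 0 < h by rewrite divr_gt0// mulr_gt0.
have hN : h * N%:R = 2 * M by rewrite divfK// gt_eqF.
move: tM; rewrite ler_norml => /andP[tM1 tM2].
have x0 : 0 <= (t + M) / h by apply: divr_ge0; [lra|exact: ltW].
have /andP[] := truncn_itv x0; set k := Num.truncn _ => k1 k2.
rewrite ler_pdivlMr// in k1; rewrite ltr_pdivrMr// in k2.
have [kN|Nk] := ltnP k N.
  exists (Ordinal kN) => /=; rewrite -/h [h * _]mulrC.
  rewrite -natr1 mulrDl mul1r in k2; move: (k%:R * h) k1 k2 => u k1 k2.
  by rewrite ler_norml; apply/andP; split; lra.
have PN : (N.-1 < N)%N by rewrite prednK.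
exists (Ordinal PN) => /=; rewrite -/h.
have NP : N%:R = N.-1%:R + 1 :> R by rewrite natr1 prednK.
have Nk' : N%:R * h <= k%:R * h by rewrite ler_pM2r// ler_nat.
have e1 : h * N.-1%:R + h = 2 * M by rewrite -hN NP mulrDr mulr1.
have e2 : N%:R * h = h * N.-1%:R + h by rewrite NP mulrDl mul1r mulrC.
rewrite e2 in Nk'; move: (h * N.-1%:R) e1 Nk' => u e1 uk.
rewrite ler_norml; apply/andP; split; lra.
Qed.
End grids.

Section L1_estimate.
Context {R : realType} {d : nat}.
Local Notation Cd := 'rV[R[i]]_d.
Local Notation tupd := ((d + d).-tuple R).
Local Notation toC := (@Cd_of_tuple R d).
Local Open Scope ereal_scope.

(** With M = f z + 2 e above the potential on the polydisc and the potential
    at least f z - e at the centre, the volume inequality gives 3 e per unit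
    volume, and f itself is within 3 e of M. *)
Lemma L1_polydisc_le (f : Cd -> R) n (q : mpoly.mpoly d R[i]) (z : Cd) (r e : R) :
  measurable_fun setT (fun x => f (toC x)) ->
  (0 < n)%N -> (0 <= r)%R -> (0 <= e)%R ->
  (forall y, polydisc z r y -> `|f y - f z| <= e)%R ->
  (forall y, log_peval n q y <= (f y + e)%:E) ->
  (f z - e)%:E <= log_peval n q z ->
  \int[lebT (d + d)]_(x in toC @^-1` polydisc z r)
     `|log_peval n q (toC x) - (f (toC x))%:E| <= (6 * e * (2 * r) ^+ (d + d))%:E.
Proof.
move=> mf n0 r0 e0 fz qf qz; set S := toC @^-1` _.
have mS : measurable S by exact: measurable_polydisc.
have qM y : polydisc z r y -> log_peval n q y <= (f z + 2 * e)%:E.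
  move=> /fz; rewrite ler_norml => /andP[_ fy]; apply: le_trans (qf y) _.
  by rewrite lee_fin; lra.
have mq := measurable_log_peval n q.
have mMq : measurable_fun setT (fun x => (f z + 2 * e)%:E - log_peval n q (toC x)).
  exact: emeasurable_funB.
have lS : lebT (d + d) S <= ((2 * r) ^+ (d + d))%:E by exact: lebT_polydisc_le.
apply: (@le_trans _ _ (\int[lebT (d + d)]_(x in S)
    (((f z + 2 * e)%:E - log_peval n q (toC x)) + (3 * e)%:E))).
  apply: ge0_le_integral => //.
  - apply: measurable_funTS; apply: measurableT_comp => //.
    by apply: emeasurable_funB => //; exact/measurable_EFinP.
  - by apply: measurable_funTS; exact: emeasurable_funD.
  move=> x Sx; have := qM _ Sx; have := qf (toC x); have := fz _ Sx.
  rewrite ler_norml => /andP[f1 f2].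
  case: (log_peval n q (toC x)) => [u| |] //=; rewrite !lee_fin => u1 u2.
  by rewrite ler_norml; apply/andP; split; lra.
rewrite ge0_integralD//; last 3 first.
- by move=> x Sx; rewrite sube_ge0 ?orbT// qM.
- exact: measurable_funTS.
- by move=> x _; rewrite lee_fin mulr_ge0.
have -> : (6 * e * (2 * r) ^+ (d + d))%:E =
    (3 * e)%:E * ((2 * r) ^+ (d + d))%:E + (3 * e)%:E * ((2 * r) ^+ (d + d))%:E.
  by rewrite -!EFinM -EFinD; congr EFin; ring.
apply: leeD.
  apply: le_trans (area_submean n0 r0 qz qM) _.
  rewrite (_ : (f z + 2 * e - (f z - e) = 3 * e)%R); last by ring.
  by rewrite lee_wpmul2l// lee_fin mulr_ge0.
by rewrite integral_cst// lee_wpmul2l// lee_fin mulr_ge0.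
Qed.

Lemma integral_le_finite_cover (I : finType) (S : set tupd) (Q : I -> set tupd)
    (g : tupd -> \bar R) :
  measurable S -> (forall i, measurable (Q i)) -> measurable_fun setT g ->
  (forall x, 0 <= g x) -> (forall x, S x -> exists i, Q i x) ->
  \int[lebT (d + d)]_(x in S) g x <= \sum_i \int[lebT (d + d)]_(x in Q i) g x.
Proof.
move=> mS mQ mg g0 SQ.
have gr A : measurable A -> measurable_fun setT (g \_ A).
  by move=> mA; apply/(measurable_restrictT g) => //; exact: measurable_funTS.
have g0r A x : 0 <= (g \_ A) x by rewrite patchE; case: ifP.
have -> : \sum_i \int[lebT (d + d)]_(x in Q i) g x =
    \int[lebT (d + d)]_x (\sum_i (g \_ (Q i)) x).
  rewrite ge0_integral_sum//; last by move=> i; exact: gr.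
  by apply: eq_bigr => i _; rewrite [LHS]integral_mkcond.
rewrite integral_mkcond; apply: ge0_le_integral => //.
- exact: gr.
- by apply: emeasurable_sum => i; exact: gr.
move=> x _; rewrite [leLHS]patchE; case: ifPn => [/set_mem /SQ[i Qx]|_].
  rewrite (bigD1 i)//= patchE mem_set// leeDl// sume_ge0// => j _.
by apply: sume_ge0.
Qed.

(** Upper bounds everywhere and lower bounds at finitely many points force
    closeness in L^1 on a cube, because the lower bound at the centre of a
    polydisc controls the whole polydisc. The N^(2d) polydiscs of radius
    6 M / N that cover the cube have total volume at most (12 M)^(2d),
    whatever N is. *)
Lemma L1_small_of_finitely_many_points (f : Cd -> R) (M eta : R) (w : nat -> Cd) :
  continuous f -> (0 < M)%R -> (0 < eta)%R -> dense (range w) ->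
  exists2 e : R, (0 < e)%R & exists rs : seq nat,
    forall n (q : mpoly.mpoly d R[i]) (S : set tupd), (0 < n)%N -> measurable S ->
      (forall x, S x -> forall i, `|tnth x i| <= M)%R ->
      (forall y, log_peval n q y <= (f y + e)%:E) ->
      (forall r, r \in rs -> (f (w r) - e)%:E <= log_peval n q (w r)) ->
      \int[lebT (d + d)]_(x in S) `|log_peval n q (toC x) - (f (toC x))%:E| < eta%:E.
Proof.
move=> cf M0 eta0 wd.
pose C := ((12 * M) ^+ (d + d))%R.
have C0 : (0 < C)%R by rewrite exprn_gt0// mulr_gt0.
pose e := (eta / (12 * C))%R.
have e0 : (0 < e)%R by rewrite divr_gt0// mulr_gt0.
exists e => //.
have [r r0 fr] := uniform_continuity_Cd (M + 1) cf e0.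
pose m0 := Num.min r 1%R.
have m00 : (0 < m0)%R by rewrite lt_min r0 ltr01.
pose N := (Num.Def.archi_bound (6 * M / m0)).+1.
have N0 : (0 < N)%N by [].
have N0' : (0 < N%:R :> R)%R by rewrite ltr0n.
have NM : (6 * M / m0 <= N%:R)%R.
  apply: (@le_trans _ _ (Num.Def.archi_bound (6 * M / m0))%:R); last by rewrite ler_nat.
  apply/ltW/archi_boundP; apply: divr_ge0; last exact: ltW.
  by rewrite mulr_ge0 ?(ltW M0).
(* Within h of each point of the grid of mesh h there is a point of the
   dense sequence; polydiscs of radius 3 h around these points cover the cube. *)
pose h := (2 * M / N%:R)%R.
have h0 : (0 < h)%R by rewrite divr_gt0// mulr_gt0.
have h3 : (3 * h <= m0)%R.
  have -> : (3 * h = 6 * M / N%:R)%R by rewrite /h; field; rewrite gt_eqF.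
  by move: NM; rewrite !ler_pdivrMr// [X in (_ <= X)%R -> _]mulrC.
have h3r : (3 * h <= r)%R by apply: le_trans h3 _; rewrite ge_min lexx.
have h31 : (3 * h <= 1)%R by apply: le_trans h3 _; rewrite ge_min lexx orbT.
pose I := {ffun 'I_(d + d) -> 'I_N}.
pose g (s : I) : tupd := [tuple (- M + h * (s i : nat)%:R)%R | i < d + d].
have wg (s : I) : exists k, forall l, (cmod (w k 0 l - toC (g s) 0 l) < h)%R.
  pose U := [set y : Cd | nbhs y [set y : Cd | forall l, cmod (y 0%R l - toC (g s) 0%R l) < h]%R].
  have oU : open U by rewrite openE => y Uy; exact: nbhs_interior Uy.
  have sU : U (toC (g s)) by apply/nbhs_CdP; exists h.
  have [y [Uy [k _ wy]]] := wd U (ex_intro _ _ sU) oU.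
  by exists k; rewrite wy; exact: (nbhs_singleton Uy).
have /choice[kk kkP] := wg.
have gM s i : (`|tnth (g s) i| <= M)%R.
  rewrite tnth_mktuple ler_norml.
  have s0 : (0 <= h * (s i : nat)%:R)%R by rewrite mulr_ge0// ltW.
  have s1 : (h * (s i : nat)%:R <= 2 * M)%R.
    have -> : (2 * M = h * N%:R)%R by rewrite /h divfK// gt_eqF.
    by rewrite ler_pM2l// ler_nat ltnW.
  by move: (h * _)%R s0 s1 => u u0 u1; apply/andP; split; lra.
exists [seq kk s | s <- enum {: I}] => n q S n0 mS SM qf qw.
have mf : measurable_fun setT (fun x => f (toC x)).
  exact: measurable_continuous_Cd.
pose Q s := toC @^-1` polydisc (w (kk s)) (3 * h).
have cover x : S x -> exists s, Q s x.
  move=> /SM xM; have /choice[s sP] := fun i => grid_interval M0 N0 (xM i).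
  exists [ffun i => s i] => k.
  have -> : (toC x 0 k - w (kk [ffun i => s i]) 0 k =
      (toC x 0 k - toC (g [ffun i => s i]) 0 k) +
      (toC (g [ffun i => s i]) 0 k - w (kk [ffun i => s i]) 0 k))%R by rewrite addrA subrK.
  apply: le_trans (cmodD _ _) _.
  have -> : (3 * h = h + h + h)%R by ring.
  apply: lerD; last by rewrite cmodB ltW.
  by apply: Cd_of_tuple_dist => i; rewrite tnth_mktuple ffunE; exact: sP.
have h30 : (0 <= 3 * h)%R by rewrite mulr_ge0// ltW.
have each s : \int[lebT (d + d)]_(x in Q s) `|log_peval n q (toC x) - (f (toC x))%:E| <=
    (6 * e * (2 * (3 * h)) ^+ (d + d))%:E.
  apply: L1_polydisc_le => //; [exact: ltW| |]; last first.
    by apply: qw; apply/mapP; exists s => //; rewrite mem_enum.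
  move=> y yz; apply: fr => k; last by apply: le_trans (yz k) h3r.
  have hh : (cmod (w (kk s) 0 k - toC (g s) 0 k) <= 1)%R.
    by apply: le_trans (ltW (kkP s k)) _; move: h31 h0; lra.
  have [h1 h2] := ReIm_le_cmod (w (kk s) 0 k - toC (g s) 0 k)%R.
  have := le_trans h1 hh; have := le_trans h2 hh.
  rewrite !raddfB /= mxE /= => im re.
  split; rewrite -[leLHS]/(`| _ |)%R.
    have := gM s (lshift d k); move: re; rewrite !ler_norml => /andP[? ?] /andP[? ?].
    by apply/andP; split; lra.
  have := gM s (rshift d k); move: im; rewrite !ler_norml => /andP[? ?] /andP[? ?].
  by apply/andP; split; lra.
have mg : measurable_fun setT (fun x => `|log_peval n q (toC x) - (f (toC x))%:E|).
  apply: measurableT_comp => //; apply: emeasurable_funB; first exact: measurable_log_peval.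
  exact/measurable_EFinP.
apply: (@le_lt_trans _ _ (\sum_(s : I) (6 * e * (2 * (3 * h)) ^+ (d + d))%:E)).
  apply: le_trans (integral_le_finite_cover mS _ mg _ cover) _ => //.
    by move=> s; exact: measurable_polydisc.
  by apply: lee_sum => s _.
rewrite sumEFin lte_fin sumr_const card_ffun !card_ord -[(_ *+ (N ^ _))%R]mulr_natr natrX.
have -> : (6 * e * (2 * (3 * h)) ^+ (d + d) * N%:R ^+ (d + d) = eta / 2)%R.
  rewrite -[LHS]mulrA -exprMn.
  have -> : (2 * (3 * h) * N%:R = 12 * M)%R by rewrite /h; field; rewrite gt_eqF.
  by rewrite -/C /e; field; rewrite gt_eqF.
by rewrite ltr_pdivrMr// ltr_pMr// ltr1n.
Qed.
End L1_estimate.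

(** * Rare events *)

Section growth.
Context {R : realType}.

Lemma ln_linear_eventually (c k : R) (D : nat) : 0 < k ->
  \forall n \near \oo, c + D%:R * ln n.+1%:R <= k * n%:R.
Proof.
move=> k0; (* log(n + 1) <= b (n + 1) - log b for every b > 0; this b makes the slope
   at most k / 2. *)
pose b := k / (2 * D.+1%:R).
have b0 : 0 < b by rewrite divr_gt0// mulr_gt0.
have lnb (n : nat) : ln n.+1%:R <= b * n.+1%:R - ln b.
  have h : ln (b * n.+1%:R) <= b * n.+1%:R.
    by apply/ltW/ln_sublinear; rewrite mulr_gt0.
  by move: h; rewrite lnM ?posrE//; lra.
pose e := c - D%:R * ln b + k / 2.
near=> n.
have Db : D%:R * b <= k / 2.
  have -> : k / 2 = D.+1%:R * b by rewrite /b; field.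
  by rewrite ler_pM2r// ler_nat.
have h1 : D%:R * ln n.+1%:R <= D%:R * b * n.+1%:R - D%:R * ln b.
  by rewrite -mulrA -mulrBr ler_wpM2l.
have h2 : D%:R * b * n.+1%:R <= k / 2 * n.+1%:R by rewrite ler_wpM2r.
have h3 : e <= k / 2 * n%:R.
  rewrite -ler_pdivrMl ?divr_gt0//; near: n; exact: nbhs_infty_ger.
have h4 : k / 2 * n.+1%:R = k / 2 * n%:R + k / 2 by rewrite -[n.+1%:R]natr1 mulrDr mulr1.
rewrite {}h4 in h2.
have -> : k * n%:R = k / 2 * n%:R + k / 2 * n%:R by field.
by move: (k / 2 * n%:R) h2 h3 => u h2; rewrite /e => h3; lra.
Unshelve. all: by end_near. Qed.
End growth.

Section rare_events.
Context {R : realType} {d0 : measure_display} {Omega : measurableType d0}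
  {P : probability Omega R} {d : nat}.
Implicit Types (m : nat -> nat) (a : nat -> nat -> {RV P >-> R[i]})
  (p : nat -> nat -> mpoly.mpoly d R[i]).
Local Notation Cd := 'rV[R[i]]_d.

Lemma measurable_cmod_itv (c : R[i]) (I : interval R) :
  measurable [set z : R[i] | cmod (z - c) \in I].
Proof.
have mc : measurable_fun setT (fun z : R[i] => cmod (z - c)).
  apply: measurable_cmod; apply: cmeasurableD; last exact: cmeasurable_cst.
  by apply: cmeasurable_comp; exact: measurable_id.
rewrite -[X in measurable X]setTI.
exact: mc measurableT _ (measurable_itv I).
Qed.

Lemma measurable_cmod_gt (X : {RV P >-> R[i]}) (t : R) :
  measurable [set w | t < cmod (X w)].
Proof.
have mX : measurable_fun setT X by [].
have := mX measurableT _ (measurable_cmod_itv 0 `]t, +oo[); rewrite setTI.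
by congr measurable; apply/seteqP; split => w /=; rewrite in_itv /= andbT subr0.
Qed.

Lemma identically_distributed_preimage m a n j n' j' (B : set R[i]) :
  iid (array_index m) (fun nj => a nj.1 nj.2) ->
  array_index m (n, j) -> array_index m (n', j') -> measurable B ->
  P (a n j @^-1` B) = P (a n' j' @^-1` B).
Proof. by move=> [_ id] nj nj' mB; have := id (n, j) (n', j') nj nj' B mB. Qed.

(** The number m_n of coefficients is at most (n+1)^d <= (2n)^d, while the tail
    at e^(dl n) is o(1 / n^d). *)
Lemma large_coefficients_rare m a p (dl e : R) :
  iid (array_index m) (fun nj => a nj.1 nj.2) ->
  (forall n j, array_index m (n, j) ->
      ((t ^+ d)%:E * P [set w | (expR t < cmod (a n j w))%R])%E @[t --> +oo%R]
        --> 0%E) ->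
  (forall n, (0 < n)%N -> is_basis (poly_le n) (m n) (p n)) ->
  0 < dl -> 0 < e ->
  \forall n \near \oo, (P (\big[setU/set0]_(j < m n)
     [set w | (expR (dl * n%:R) < cmod (a n j w))%R]) < e%:E)%E.
Proof.
move=> ad at_ pb dl0 e0.
have m1 : (0 < m 1)%N := basis_poly_le_gt0 (pb 1%N isT).
have i1 : array_index m (1%N, 0%N) by [].
pose T t := fine (P [set w | expR t < cmod (a 1%N 0%N w)]).
have TE t : P [set w | expR t < cmod (a 1%N 0%N w)] = (T t)%:E.
  by rewrite fineK// fin_num_measure//; exact: measurable_cmod_gt.
have T0 t : 0 <= T t by rewrite fine_ge0// measure_ge0.
have e'0 : 0 < (dl / 2) ^+ d * e by rewrite mulr_gt0// exprn_gt0// divr_gt0.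
have : \forall t \near +oo%R, ((t ^+ d)%:E *
    P [set w | (expR t < cmod (a 1%N 0%N w))%R] < ((dl / 2) ^+ d * e)%:E)%E.
  apply: (at_ 1%N 0%N i1 [set x | (x < ((dl / 2) ^+ d * e)%:E)%E]).
  by apply: open_nbhs_nbhs; split; [exact: open_ereal_lt_ereal|rewrite /= lte_fin].
move=> [M [_ MT]].
near=> n.
have n0 : (0 < n)%N by near: n; exists 1%N.
have n0' : 0 < n%:R :> R by rewrite ltr0n.
have nM : M < dl * n%:R.
  rewrite -ltr_pdivrMl//; near: n; exact: nbhs_infty_gtr.
have {MT} := MT _ nM; rewrite TE -EFinM lte_fin => Tn.
apply: (@le_lt_trans _ _ ((m n)%:R * T (dl * n%:R))%:E).
  pose A j := [set w | expR (dl * n%:R) < cmod (a n j w)].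
  have mA j : (j < m n)%N -> measurable (A j) by move=> _; exact: measurable_cmod_gt.
  apply: (le_trans (Boole_inequality P mA)).
  have -> : ((m n)%:R * T (dl * n%:R))%:E = (\sum_(j < m n) (T (dl * n%:R))%:E)%E.
    by rewrite sumEFin sumr_const card_ord mulr_natl.
  apply: lee_sum => j _; rewrite -TE.
  pose B := [set z : R[i] | expR (dl * n%:R) < cmod z].
  have mB : measurable B.
    have := measurable_cmod_itv 0 `]expR (dl * n%:R), +oo[.
    by congr measurable; apply/seteqP; split => w /=; rewrite in_itv /= andbT subr0.
  rewrite le_eqVlt; apply/orP; left; apply/eqP.
  exact: identically_distributed_preimage ad (conj n0 (ltn_ord j)) i1 mB.
rewrite lte_fin.
have mn : (m n)%:R <= (2 * n%:R) ^+ d :> R.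
  apply: (@le_trans _ _ (n.+1%:R ^+ d)).
    by rewrite -natrX ler_nat; exact: basis_poly_le_card (pb n n0).
  rewrite lerXn2r ?nnegrE ?mulr_ge0// -natrM ler_nat mul2n -addnn -addn1 leq_add2l//.
apply: (@le_lt_trans _ _ ((2 / dl) ^+ d * ((dl * n%:R) ^+ d * T (dl * n%:R)))).
  rewrite mulrA -exprMn.
  have -> : 2 / dl * (dl * n%:R) = 2 * n%:R by field; rewrite gt_eqF.
  by rewrite ler_wpM2r.
have -> : e = (2 / dl) ^+ d * ((dl / 2) ^+ d * e).
  rewrite mulrA -exprMn; have -> : 2 / dl * (dl / 2) = 1 by field; rewrite gt_eqF.
  by rewrite expr1n mul1r.
by rewrite ltr_pM2l// exprn_gt0// divr_gt0.
Unshelve. all: by end_near. Qed.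

(** The small ball inequality applied to the n-th row, with the j0-th term
    singled out. *)
Lemma Hfun_small_ball m a p n (j0 : 'I_(m n)) (z : Cd) (r q : R) :
  mutually_independent (array_index m) (fun nj => a nj.1 nj.2) ->
  (0 < n)%N -> peval (p n j0) z != 0 -> 0 < r ->
  (concentration P (a n j0) (2 * r / cmod (peval (p n j0) z)) <= q%:E)%E ->
  (P [set w | (cmod (Hfun m p (fun n j => a n j) n w z) < r)%R] <= q%:E)%E.
Proof.
move=> ind n0 c0 r0 cq.
pose X (nj : nat * nat) := a nj.1 nj.2.
pose c (nj : nat * nat) := peval (p nj.1 nj.2) z.
pose i0 := (n, j0 : nat).
pose u := [seq (n, nat_of_ord j) | j <- index_enum 'I_(m n) & j != j0].
have us : uniq (i0 :: u).
  rewrite cons_uniq; apply/andP; split; last first.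
    by rewrite map_inj_uniq ?filter_uniq ?index_enum_uniq// => j k [/val_inj].
  apply/negP => /mapP[j]; rewrite mem_filter => /andP[jj0 _] [/val_inj jE].
  by rewrite jE eqxx in jj0.
have uA i : i \in i0 :: u -> array_index m i.
  by rewrite inE => /predU1P[->|/mapP[j _ ->]]; split => //=.
have HE w : Hfun m p (fun n j => a n j) n w z = \sum_(i <- i0 :: u) X i w * c i.
  rewrite /Hfun (bigD1 j0)//= big_cons; congr (_ + _).
  by rewrite big_map big_filter.
have -> : [set w | cmod (Hfun m p (fun n j => a n j) n w z) < r] =
    [set w | cmod (\sum_(i <- i0 :: u) X i w * c i) < r].
  by apply/seteqP; split => w /=; rewrite HE.
exact: (small_ball_sum ind us uA c0 r0 cq).
Qed.

Lemma concentration_identically_distributed m a n j n' j' (r : R) :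
  iid (array_index m) (fun nj => a nj.1 nj.2) ->
  array_index m (n, j) -> array_index m (n', j') ->
  concentration P (a n j) r = concentration P (a n' j') r.
Proof.
move=> ad nj nj'; rewrite /concentration; congr ereal_sup; apply/seteqP.
have bE v : P [set w | cmod (a n j w - v) < r] = P [set w | cmod (a n' j' w - v) < r].
  have := identically_distributed_preimage ad nj nj' (measurable_cmod_itv v `]-oo, r[).
  have S Y : Y @^-1` [set x : R[i] | cmod (x - v) \in `]-oo, r[] =
      [set w : Omega | cmod (Y w - v) < r].
    by apply/seteqP; split => w /=; rewrite in_itv.
  by rewrite (S (a n j)) (S (a n' j')).
by split => _ [v _ <-]; exists v.
Qed.

(** Single out the term with the largest |p_nj(z)|, for which
    B_n(z)^(1/2) <= m_n |p_nj(z)|. The relevant radius is then at most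
    2 m_n e^(- dl n), which tends to 0. *)
Lemma small_values_rare m a p (z : Cd) (dl e : R) :
  iid (array_index m) (fun nj => a nj.1 nj.2) ->
  (forall n j, array_index m (n, j) ->
      concentration P (a n j) r @[r --> 0^'+] --> 0%E) ->
  (forall n, (0 < n)%N -> is_basis (poly_le n) (m n) (p n)) ->
  (forall n, (0 < n)%N -> p n 0%N = 1) ->
  0 < dl -> 0 < e ->
  \forall n \near \oo, (P [set w | (cmod (Hfun m p (fun n j => a n j) n w z) <
      expR (- (dl * n%:R)) * Num.sqrt (Bfun m p n z))%R] <= e%:E)%E.
Proof.
move=> ad ac pb p1 dl0 e0.
have m1 : (0 < m 1)%N := basis_poly_le_gt0 (pb 1%N isT).
have i1 : array_index m (1%N, 0%N) by [].
have : \forall r \near 0^'+, (concentration P (a 1%N 0%N) r < e%:E)%E.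
  apply: (ac 1%N 0%N i1 [set x | (x < e%:E)%E]).
  by apply: open_nbhs_nbhs; split; [exact: open_ereal_lt_ereal|rewrite /= lte_fin].
move=> [s /= s0 sQ].
near=> n.
have n0 : (0 < n)%N by near: n; exists 1%N.
have mn0 : (0 < m n)%N := basis_poly_le_gt0 (pb n n0).
have B1 : 1 <= Bfun m p n z by exact: Bfun_ge1 (p1 n n0).
have B0 : 0 < Num.sqrt (Bfun m p n z) by rewrite sqrtr_gt0 (lt_le_trans ltr01).
have [j0 _ j0max] := @arg_maxP _ _ _ (Ordinal mn0) xpredT
  (fun j : 'I_(m n) => cmod (peval (p n j) z)) isT.
have Bj : Bfun m p n z <= (m n)%:R * cmod (peval (p n j0) z) ^+ 2.
  apply: (@le_trans _ _ (\sum_(j < m n) cmod (peval (p n j0) z) ^+ 2)).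
    apply: ler_sum => j _.
    by rewrite lerXn2r ?nnegrE ?cmod_ge0//; exact: j0max.
  by rewrite sumr_const card_ord -[leLHS]mulr_natl.
have c0 : 0 < cmod (peval (p n j0) z).
  rewrite lt_neqAle cmod_ge0 andbT eq_sym; apply: contraTneq (lt_le_trans ltr01 (le_trans B1 Bj)) => ->.
  by rewrite expr0n mulr0 ltxx.
pose r := expR (- (dl * n%:R)) * Num.sqrt (Bfun m p n z).
have r0 : 0 < r by rewrite mulr_gt0 ?expR_gt0.
pose c := cmod (peval (p n j0) z).
apply: (@Hfun_small_ball m a p n j0 z r e ad.1 n0 _ r0); first by rewrite -cmod_gt0.
rewrite (concentration_identically_distributed _ ad (conj n0 (ltn_ord j0)) i1).
have rho0 : 0 < 2 * r / c by rewrite divr_gt0// mulr_gt0.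
apply/ltW/sQ => //=.
rewrite sub0r normrN gtr0_norm// ltr_pdivrMr//.
have mR : 1 <= (m n)%:R :> R by rewrite ler1n.
have sB : Num.sqrt (Bfun m p n z) <= (m n)%:R * c.
  rewrite -[leRHS]ger0_norm ?mulr_ge0 ?cmod_ge0// -sqrtr_sqr ler_wsqrtr//.
  apply: le_trans Bj _; rewrite exprMn ler_wpM2r ?exprn_ge0 ?cmod_ge0//.
  by rewrite expr2 ler_peMl.
apply: (@le_lt_trans _ _ (2 * expR (- (dl * n%:R)) * (m n)%:R * c)).
  by rewrite /r -!mulrA ler_pM2l// ler_pM2l ?expR_gt0.
rewrite ltr_pM2r//.
have h : ln 2 - ln s + 1 + d%:R * ln n.+1%:R <= dl * n%:R.
  by near: n; exact: ln_linear_eventually.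
have lm := ln_basis_card (pb n n0).
have -> : 2 * expR (- (dl * n%:R)) * (m n)%:R = expR (ln 2 - dl * n%:R + ln (m n)%:R).
  by rewrite !expRD !lnK ?posrE ?ltr0n.
apply: (@le_lt_trans _ _ (expR (ln s - 1))); first by rewrite ler_expR; lra.
by rewrite -[ltRHS]lnK ?posrE// ltr_expR ltrBlDr ltrDl.
Unshelve. all: by end_near. Qed.
End rare_events.

(** * Random polynomials *)

Section random_polynomials.
Context {R : realType} {d0 : measure_display} {Omega : measurableType d0}
  {P : probability Omega R} {d : nat}.
Implicit Types (m : nat -> nat) (a : nat -> nat -> {RV P >-> R[i]})
  (p : nat -> nat -> mpoly.mpoly d R[i]).
Local Notation Cd := 'rV[R[i]]_d.
Local Notation tupd := ((d + d).-tuple R).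
Local Notation toC := (@Cd_of_tuple R d).

Definition Hpoly m p a n (w : Omega) : mpoly.mpoly d R[i] :=
  \sum_(j < m n) a n j w *: p n j.

Lemma Hfun_peval m p a n w z :
  Hfun m p (fun n j => a n j) n w z = peval (Hpoly m p a n w) z.
Proof.
rewrite /peval /Hpoly raddf_sum /Hfun; apply: eq_bigr => j _.
by rewrite /= mpoly.mevalZ.
Qed.

Lemma measurable_Hfun m p a n :
  measurable_fun setT (fun q : Omega * tupd => cmod (Hfun m p (fun n j => a n j) n q.1 (toC q.2))).
Proof.
apply: measurable_cmod; apply: cmeasurable_sum => j; apply: cmeasurableM.
  apply: cmeasurable_comp; apply: (measurableT_comp (f := a n j)) => //.
exact: (cmeasurable_peval (g := snd)).
Qed.

(** By Fubini-Tonelli, the L^1 distance is a measurable function of the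
    outcome. *)
Lemma measurable_L1_event m p a n (f : Cd -> R) (L : set Cd) (e : R) :
  continuous f -> compact L ->
  measurable [set w | (e%:E <= int_Cd L (fun z =>
     `|log_peval n (Hpoly m p a n w) z - (f z)%:E|))%E].
Proof.
move=> cf cL.
pose S := toC @^-1` L.
have mS : measurable S by apply: measurable_closed_Cd; exact: compact_Cd_closed.
have mf : measurable_fun setT (fun x => f (toC x)).
  exact: measurable_continuous_Cd.
pose G0 (q : Omega * tupd) :=
  `|log_peval n (Hpoly m p a n q.1) (toC q.2) - (f (toC q.2))%:E|%E.
have mG0 : measurable_fun setT G0.
  apply: measurableT_comp => //; apply: emeasurable_funB.
    apply: measurable_funeM; apply: measurable_lne_EFin.
    have := @measurable_Hfun m p a n.
    by under eq_fun do rewrite Hfun_peval.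
  by apply/measurable_EFinP; exact: (measurableT_comp mf).
have mTS : measurable (setT `*` S : set (Omega * tupd)) by exact: measurableX.
pose G := G0 \_ (setT `*` S).
have mG : measurable_fun setT G.
  by apply/(measurable_restrictT G0) => //; exact: measurable_funTS.
have G_ge0 q : (0 <= G q)%E by rewrite /G patchE; case: ifP => // _; exact: abse_ge0.
have mI := @measurable_fun_fubini_tonelli_F _ _ _ _ R (lebT (d + d)) G mG G_ge0.
rewrite -[X in measurable X]setTI.
have := mI measurableT _ (emeasurable_itv `[e%:E, +oo[).
congr measurable; congr (_ `&` _); apply/seteqP.
have IE w : fubini_F (lebT (d + d)) G w = int_Cd L (fun z =>
     `|log_peval n (Hpoly m p a n w) z - (f z)%:E|)%E.
  rewrite /fubini_F /int_Cd [RHS]integral_mkcond; apply: eq_integral => x _.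
  rewrite /G !patchE; congr (if _ then _ else _).
  by apply/idP/idP; rewrite !inE; [case|split].
by split => w /=; rewrite -IE in_itv /= ?andbT.
Qed.

(** Almost surely H_n does not vanish at the origin: the first basis element
    is 1, so the small ball inequality bounds the probability of |H_n(0)| < r
    by a quantity that tends to 0 with r. *)
Lemma log_peval_Hpoly_ae_L1loc m p a n :
  iid (array_index m) (fun nj => a nj.1 nj.2) ->
  (forall n j, array_index m (n, j) ->
      concentration P (a n j) r @[r --> 0^'+] --> 0%E) ->
  (forall n, (0 < n)%N -> is_basis (poly_le n) (m n) (p n)) ->
  (forall n, (0 < n)%N -> p n 0%N = 1) -> (0 < n)%N ->
  {ae P, forall w, L1loc (log_peval n (Hpoly m p a n w))}.
Proof.
move=> ad ac pb p1 n0.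
have mn0 : (0 < m n)%N := basis_poly_le_gt0 (pb n n0).
pose E := [set w | cmod (Hfun m p (fun n j => a n j) n w 0) <= 0].
have mH : measurable_fun setT (fun w => cmod (Hfun m p (fun n j => a n j) n w 0)).
  apply: measurable_cmod; apply: cmeasurable_sum => j; apply: cmeasurableM.
    exact: cmeasurable_comp.
  exact: cmeasurable_cst.
have mE : measurable E.
  rewrite -[X in measurable X]setTI.
  by have := mH measurableT _ (measurable_itv `]-oo, 0]); rewrite set_itvE.
exists E; split => //; last first.
  move=> w /= nL; rewrite /E /= leNgt; apply: contra_notN nL => H0.
  apply: (@log_peval_L1loc _ _ n _ 0 n0).
  by rewrite -Hfun_peval -cmod_gt0.
apply/eqP; rewrite eq_le measure_ge0 andbT; apply/lee_addgt0Pr => e e0; rewrite add0e.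
have : \forall r \near 0^'+, (concentration P (a n 0%N) r < e%:E)%E.
  apply: (ac n 0%N (conj n0 mn0) [set x | (x < e%:E)%E]).
  by apply: open_nbhs_nbhs; split; [exact: open_ereal_lt_ereal|rewrite /= lte_fin].
move=> [s /= s0 sQ].
pose r := s / 4.
have r0 : 0 < r by rewrite divr_gt0.
have p0 : peval (p n (Ordinal mn0)) 0 = 1 by rewrite /= p1// peval1.
have c0 : peval (p n (Ordinal mn0)) 0 != 0 by rewrite p0 oner_neq0.
apply: le_trans (@Hfun_small_ball R d0 Omega P d m a p n (Ordinal mn0) 0 r e ad.1 n0 c0 r0 _).
  apply: le_measure; rewrite ?inE//; last by move=> w /= /le_lt_trans; apply.
  rewrite -[X in measurable X]setTI.
  by have := mH measurableT _ (measurable_itv `]-oo, r[); rewrite set_itvE.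
rewrite p0 ComplexField.Normc.normc1 divr1; apply/ltW/sQ => /=; last by rewrite mulr_gt0.
by rewrite sub0r normrN gtr0_norm ?mulr_gt0// /r; lra.
Qed.

Lemma log_peval_Hpoly_upper m p a n w (f : Cd -> R) (dl : R) :
  (0 < n)%N -> (0 < m n)%N ->
  (forall (j : 'I_(m n)) z, (log_peval n (p n j) z <= (f z)%:E)%E) ->
  (forall j : 'I_(m n), cmod (a n j w) <= expR (dl * n%:R)) ->
  ln (m n)%:R <= dl * n%:R ->
  forall z, (log_peval n (Hpoly m p a n w) z <= (f z + 2 * dl)%:E)%E.
Proof.
move=> n0 m0 pf aw lm z; rewrite log_peval_leP// -Hfun_peval.
apply: le_trans (cmod_sum_le _ _ _) _.
apply: (@le_trans _ _ (\sum_(j < m n) expR (dl * n%:R) * expR (n%:R * f z))).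
  apply: ler_sum => j _; rewrite cmodM; apply: ler_pM; rewrite ?cmod_ge0//.
  by rewrite -log_peval_leP//; exact: pf.
rewrite sumr_const card_ord -[leLHS]mulr_natl -[(m n)%:R]lnK ?posrE ?ltr0n// -!expRD ler_expR.
have -> : n%:R * (f z + 2 * dl) = dl * n%:R + (dl * n%:R + n%:R * f z) by ring.
by rewrite lerD2r.
Qed.

Lemma log_peval_Hpoly_lower m p a n w (z : Cd) (v dl : R) :
  (0 < n)%N -> 1 <= Bfun m p n z ->
  expR (- (dl * n%:R)) * Num.sqrt (Bfun m p n z) <=
    cmod (Hfun m p (fun n j => a n j) n w z) ->
  v - dl <= (2 * n%:R)^-1 * ln (Bfun m p n z) ->
  ((v - 2 * dl)%:E <= log_peval n (Hpoly m p a n w) z)%E.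
Proof.
move=> n0 B1 HB vB; have n0' : 0 < n%:R :> R by rewrite ltr0n.
have B0 : 0 < Bfun m p n z by exact: lt_le_trans B1.
have sB0 : 0 < Num.sqrt (Bfun m p n z) by rewrite sqrtr_gt0.
have H0 : 0 < cmod (Hfun m p (fun n j => a n j) n w z).
  by apply: lt_le_trans HB; rewrite mulr_gt0 ?expR_gt0.
rewrite /log_peval -Hfun_peval lne_EFin// -EFinM lee_fin ler_pdivlMl//.
have : ln (expR (- (dl * n%:R)) * Num.sqrt (Bfun m p n z)) <=
    ln (cmod (Hfun m p (fun n j => a n j) n w z)).
  by rewrite ler_ln ?posrE// mulr_gt0 ?expR_gt0.
rewrite lnM ?posrE ?expR_gt0// expRK; apply: le_trans.
have lB : ln (Bfun m p n z) = ln (Num.sqrt (Bfun m p n z)) *+ 2.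
  by rewrite -lnXn// sqr_sqrtr// ltW.
move: vB; rewrite ler_pdivlMl ?mulr_gt0// lB mulr2n.
have -> : n%:R * (v - 2 * dl) = n%:R * (v - dl) - dl * n%:R by ring.
have -> : 2 * n%:R * (v - dl) = n%:R * (v - dl) + n%:R * (v - dl) by ring.
by move: (n%:R * (v - dl)) (dl * n%:R) (ln _) => x y u; lra.
Qed.

End random_polynomials.

(** * Convergence in probability *)

Lemma infinite_set_not_near (Y : set nat) : ~ (\forall n \near \oo, ~ Y n) -> infinite_set Y.
Proof.
move=> nY /finite_seqP[s Ys]; apply: nY; exists (\max_(i <- s) i).+1 => // n /= sn.
rewrite Ys /= => ns; move: sn; rewrite ltnNge => /negP; apply.
exact: (leq_bigmax_seq n ns isT).
Qed.

Lemma near_forall_seq (T : eqType) (F : set_system nat) (s : seq T) (Q : T -> nat -> Prop) :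
  Filter F -> (forall r, r \in s -> \forall n \near F, Q r n) ->
  \forall n \near F, forall r, r \in s -> Q r n.
Proof.
move=> FF; elim: s => [|r s IH] H; first exact: nearW.
have H1 := H r (mem_head _ _).
have H2 := IH (fun r' rs => H r' (mem_behead (s := r :: s) rs)).
apply: filterS2 H1 H2 => n Q1 Q2 r'.
by rewrite inE => /predU1P[->|/Q2].
Qed.

Theorem theorem3p1 (R : realType) (d0 : measure_display)
    (Omega : measurableType d0) (P : probability Omega R)
    (d : nat) (d_gt0 : (0 < d)%N)
    (m : nat -> nat) (p : nat -> nat -> mpoly.mpoly d R[i])
    (a : nat -> nat -> {RV P >-> R[i]}) (K : set 'rV[R[i]]_d)
    (a_iid : iid (array_index m) (fun nj => a nj.1 nj.2))
    (a_nondeg : forall n j, array_index m (n, j) -> nondegenerate_rv P (a n j))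
    (a_tail : forall n j, array_index m (n, j) ->
      ((t ^+ d)%:E * P [set w | (expR t < cmod (a n j w))%R])%E @[t --> +oo%R]
        --> 0%E)
    (a_conc : forall n j, array_index m (n, j) ->
      concentration P (a n j) r @[r --> 0^'+] --> 0%E)
    (K_compact : compact K) (K_regular : regular_set K)
    (p_basis : forall n, (0 < n)%N -> is_basis (poly_le n) (m n) (p n))
    (p_first : forall n, (0 < n)%N -> p n 0%N = 1)
    (p_norm : forall n j, array_index m (n, j) -> (sup_norm K (p n j) <= 1)%E)
    (B_lim : forall Y : set nat, infinite_set Y ->
      exists2 Y0 : set nat, infinite_set Y0 /\ Y0 `<=` Y &
      exists2 w : nat -> 'rV[R[i]]_d, dense (range w) &
      forall r, ((2 * n%:R)^-1 * ln (Bfun m p n (w r)))%:E @[n --> within Y0 \oo]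
        --> extremal_fun K (w r)) :
  cvg_in_probability_L1loc P
    (fun n w z => (n%:R^-1)%:E * lne (cmod (Hfun m p a n w z))%:E)%E
    (extremal_fun K).
Proof.
have FE n w : (fun z => (n%:R^-1)%:E * lne (cmod (Hfun m p a n w z))%:E)%E =
    log_peval n (Hpoly m p a n w).
  by apply/funext => z; rewrite /log_peval -Hfun_peval.
have Vlty z : (extremal_fun K z < +oo)%E.
  have [Y0 [Y0oo _] [w wd wl]] := B_lim setT infinite_nat.
  exact: (extremal_fun_lty K_regular p_basis p_first p_norm Y0oo wd wl).
pose f z := fine (extremal_fun K z).
have fE z : extremal_fun K z = (f z)%:E.
  by rewrite fineK// ge0_fin_numE ?extremal_ge0.
have VE : extremal_fun K = EFin \o f by apply/funext => z; exact: fE.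
have cf : continuous f.
  move=> z; have Vz : extremal_fun K y @[y --> z] --> (f z)%:E.
    by rewrite -fE; exact: K_regular.2.
  exact: fine_cvg Vz.
have pf n (j : 'I_(m n)) z : (0 < n)%N -> (log_peval n (p n j) z <= (f z)%:E)%E.
  move=> n0; rewrite -fE; apply: log_peval_le_extremal => //.
    by have [+ _ _] := p_basis n n0; apply; exact: ltn_ord.
  by apply: p_norm; split => //=.
split.
- by rewrite VE; exact: continuous_L1loc.
- move=> n n0.
  have := log_peval_Hpoly_ae_L1loc a_iid a_conc p_basis p_first n0.
  by apply: filterS => w; rewrite FE.
move=> L eps cL eps0.
pose E n := [set w | (eps%:E <= int_Cd L (fun z =>
  `|log_peval n (Hpoly m p a n w) z - (f z)%:E|))%E].
have -> : (fun n => P [set w | (eps%:E <= int_Cd L (fun z =>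
    `|(n%:R^-1)%:E * lne (cmod (Hfun m p a n w z))%:E - extremal_fun K z|))%E]) =
    (fun n => P (E n)).
  apply/funext => n; congr (P _); apply/seteqP.
  have IE w : int_Cd L (fun z =>
      `|(n%:R^-1)%:E * lne (cmod (Hfun m p a n w z))%:E - extremal_fun K z|)%E =
      int_Cd L (fun z => `|log_peval n (Hpoly m p a n w) z - (f z)%:E|)%E.
    congr int_Cd; apply/funext => z; rewrite fE.
    by have := congr1 (fun g => g z) (FE n w) => /= ->.
  by split => w /=; rewrite IE.
have mE n : measurable (E n) by exact: measurable_L1_event.
have finE n : P (E n) \is a fin_num by rewrite fin_num_measure.
apply/fine_cvgP; split; first exact: nearW.
apply/cvgrPdist_lt => e e0; apply: contrapT => not_near.
have Yoo : infinite_set [set n | ~ `|0 - fine (P (E n))| < e].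
  by apply: infinite_set_not_near => H; apply: not_near; apply: filterS H => n /contrapT.
have [Y0 [Y0oo Y0Y] [w wd wl]] := B_lim _ Yoo.
have FY := within_infinite_proper Y0oo.
have [M M0 LM] := compact_Cd_bounded cL.
have [e1 e10 [rs rsP]] := L1_small_of_finitely_many_points cf M0 eps0 wd.
pose dl := e1 / 2.
have dl0 : 0 < dl by rewrite divr_gt0.
(* With e / k for each chosen point, all the small-value events together
   have probability at most e / 2. *)
pose k := (size rs).+1%:R * 2 : R.
have k0 : 0 < k by rewrite mulr_gt0.
have near_oo (Q : nat -> Prop) : (\forall n \near \oo, Q n) ->
    \forall n \near within Y0 \oo, Q n.
  by apply: filterS => n Qn _.
pose A n := \big[setU/set0]_(j < m n) [set v | expR (dl * n%:R) < cmod (a n j v)].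
pose S r n := [set v | (cmod (Hfun m p a n v (w r)) <
      expR (- (dl * n%:R)) * Num.sqrt (Bfun m p n (w r)))%R].
have nA : \forall n \near within Y0 \oo, (P (A n) < (e / 2)%:E)%E.
  by apply/near_oo/(large_coefficients_rare a_iid a_tail p_basis dl0); rewrite divr_gt0.
have nS : \forall n \near within Y0 \oo, forall r, r \in rs -> (P (S r n) <= (e / k)%:E)%E.
  apply: near_forall_seq => r _; apply: near_oo.
  by apply: (small_values_rare _ a_iid a_conc p_basis p_first dl0); rewrite divr_gt0.
have nB : \forall n \near within Y0 \oo, forall r, r \in rs ->
    f (w r) - dl <= (2 * n%:R)^-1 * ln (Bfun m p n (w r)).
  apply: near_forall_seq => r _.
  have := wl r; rewrite fE => /(_ [set x | ((f (w r) - dl)%:E < x)%E]) H.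
  have {H} : \forall n \near within Y0 \oo,
      ((f (w r) - dl)%:E < ((2 * n%:R)^-1 * ln (Bfun m p n (w r)))%:E)%E.
    apply: H; apply: open_nbhs_nbhs; split; first exact: open_ereal_gt_ereal.
    by rewrite /= lte_fin gtrBl.
  by apply: filterS => n; rewrite lte_fin => /ltW.
have nm : \forall n \near within Y0 \oo, d%:R * ln n.+1%:R <= dl * n%:R.
  apply: near_oo; have := @ln_linear_eventually R 0 dl d dl0.
  by apply: filterS => n; rewrite add0r.
have n1 : \forall n \near within Y0 \oo, (0 < n)%N by apply: near_oo; exists 1%N.
have nY : \forall n \near within Y0 \oo, Y0 n by exact: withinT.
have [n [[[n0 Yn] [An Sn]] [Bn mn]]] := filter_ex (filterI (filterI (filterI n1 nY)
  (filterI nA nS)) (filterI nB nm)).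
have := Y0Y n Yn; apply => /=.
rewrite sub0r normrN ger0_norm ?fine_ge0//.
have mn0 : (0 < m n)%N := basis_poly_le_gt0 (p_basis n n0).
have mA : measurable (A n).
  by apply: bigsetU_measurable => j _; exact: measurable_cmod_gt.
have mS r : measurable (S r n).
  have mH : measurable_fun setT (fun v => cmod (Hfun m p a n v (w r))).
    apply: measurable_cmod; apply: cmeasurable_sum => j; apply: cmeasurableM.
      exact: cmeasurable_comp.
    exact: cmeasurable_cst.
  rewrite -[X in measurable X]setTI.
  by have := mH measurableT _ (measurable_itv `]-oo, (expR (- (dl * n%:R)) *
    Num.sqrt (Bfun m p n (w r)))[); rewrite set_itvE.
have mU : measurable (\big[setU/set0]_(i < size rs) S (nth 0%N rs i) n).
  by apply: bigsetU_measurable => i _; exact: mS.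
(* Outside the rare events the upper bound holds everywhere and the lower
   bounds hold at the chosen points. *)
have EU : E n `<=` A n `|` \big[setU/set0]_(i < size rs) S (nth 0%N rs i) n.
  move=> v Ev; apply: contrapT => /not_orP[nAv nSv].
  move: Ev; rewrite /E /= leNgt => /negP; apply.
  apply: rsP => //.
  - by apply: measurable_closed_Cd; exact: compact_Cd_closed.
  - move=> x Lx i; rewrite -(splitK i); have LMx := LM _ Lx.
    case: (fintype.split i) => l; have := LMx l; rewrite !mxE subr0;
      have [h1 h2] := ReIm_le_cmod (tnth x (lshift d l) +i* tnth x (rshift d l)) => xM.
      exact: le_trans h1 xM.
    exact: le_trans h2 xM.
  - move=> z; have -> : e1 = 2 * dl by rewrite /dl mulrC divfK.
    apply: log_peval_Hpoly_upper => //.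
    + by move=> j y; exact: pf.
    + move=> j; rewrite leNgt; apply/negP => av; apply: nAv.
      by rewrite /A (bigD1 j)//=; left.
    + by apply: le_trans mn; exact: ln_basis_card (p_basis n n0).
  move=> r rrs; have -> : e1 = 2 * dl by rewrite /dl mulrC divfK.
  apply: log_peval_Hpoly_lower => //.
  - exact: Bfun_ge1 (p_first n n0).
  - rewrite leNgt; apply/negP => Sv; apply: nSv.
    have ir : (index r rs < size rs)%N by rewrite index_mem.
    by rewrite (bigD1 (Ordinal ir))//=; left; rewrite nth_index.
  - exact: Bn.
rewrite -lte_fin fineK//.
apply: (le_lt_trans (le_measure P _ _ EU)); rewrite ?inE//; first exact: measurableU.
apply: (le_lt_trans (measureU2 _ _ _)) => //.
rewrite [e]splitr EFinD; apply: lte_leD => //; first by rewrite fin_num_measure.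
pose Si i := S (nth 0%N rs i) n.
have mSi i : (i < size rs)%N -> measurable (Si i) by move=> _; exact: mS.
apply: (le_trans (Boole_inequality P mSi)).
apply: (@le_trans _ _ (\sum_(i < size rs) (e / k)%:E)%E).
  by apply: lee_sum => i _; apply: Sn; exact: mem_nth.
rewrite sumEFin sumr_const card_ord lee_fin -[leLHS]mulr_natl.
rewrite mulrCA ler_pM2l// ler_pdivrMr// /k.
by rewrite mulrCA mulVf// mulr1 ler_nat.
Qed.
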